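(* Let $E$ be a finite set, and let $\mathcal{V}\subseteq \Gamma_{\max}^E$. There is a left $\Gamma_{\max}$-matroid $M$ such that $\mathcal{V}=\mathcal{V}(M)$ if and only if (V0) $0\in \mathcal{V}$; (V1) if $a\in \Gamma$ and $V\in \mathcal{V}$, then $aV\in \mathcal{V}$; (V2) if $V, W\in \mathcal{V}$, then $V\circ W\in \mathcal{V}$; (V3) if $V, W\in \mathcal{V}, e\in E$ such that $V_e=-W_e\neq 0$, then there is a $Z\in \mathcal{V}$ such that $Z_f\in V_f\boxplus W_f$ for all $f\in E$ and $Z_e=0$. Then $\mathcal{C}(M)=\mathrm{Min}(\mathcal{V}\setminus\{0\})$.
   Context: $\Gamma_{\max}$ is the skew hyperfield on $\Gamma\cup\{0\}$ for a totally ordered group $\Gamma$, with multiplication from $\Gamma$ and hyperaddition $x\boxplus y=\{\max\{x,y\}\}$ if $x\neq y$, $x\boxplus x=\{z\in\Gamma: z\le x\}\cup\{0\}$, $0<x$ for $x\in\Gamma$ (so $-x=x$). $V\circ W$ is the componentwise maximum. $\mathcal V(M)$ is the set of vectors of $M$: the $V$ with $0\in V_{e_1}Y_{e_1}\boxplus\cdots\boxplus V_{e_n}Y_{e_n}$ for all cocircuits $Y$ of $M$ ($E=\{e_1,\dots,e_n\}$). $\mathcal C(M)$ is the set of circuits. $\mathrm{Min}(\mathcal Q)$ is the set of elements of $\mathcal Q$ with inclusion-minimal support among elements of $\mathcal Q$. *)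

(* Defs.v *)
From HB Require Import structures.
From mathcomp Require Import all_boot all_order.
From mathcomp Require Import monoid.
From mathcomp Require Import boolp classical_sets.

Set Implicit Arguments.
Unset Strict Implicit.
Unset Printing Implicit Defensive.

Import Order.TTheory.

Declare Scope hyper_scope.
Delimit Scope hyper_scope with H.

Local Open Scope classical_set_scope.

(* Not necessarily commutative; the order is compatible with multiplication
   on both sides. *)
HB.mixin Record Group_Total_isOrderedGroup (d : Order.disp_t) G
    of Group G & Order.Total d G := {
  lemul2l : forall z x y : G, (x <= y)%O -> ((z * x)%g <= (z * y)%g)%O;
  lemul2r : forall z x y : G, (x <= y)%O -> ((x * z)%g <= (y * z)%g)%O;
}.

#[short(type="orderedGroupType")]
HB.structure Definition OrderedGroup (d : Order.disp_t) :=
  {G of Group G & Order.Total d G & Group_Total_isOrderedGroup d G}.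

HB.mixin Record isSkewHyperfield H of Choice H := {
  hzero : H;
  hone : H;
  hmul : H -> H -> H;
  hadd : H -> H -> set H;
  hopp : H -> H;
  hadd_neq0 : forall x y, hadd x y !=set0;
  haddC : forall x y, hadd x y = hadd y x;
  haddA : forall x y z,
    \bigcup_(t in hadd y z) hadd x t = \bigcup_(t in hadd x y) hadd t z;
  haddx0 : forall x, hadd x hzero = [set x];
  haddN : forall x y, hadd x y hzero <-> y = hopp x;
  hadd_rev : forall x y z, hadd y z x -> hadd x (hopp y) z;
  hmulA : forall x y z, hmul x (hmul y z) = hmul (hmul x y) z;
  hmul1x : forall x, hmul hone x = x;
  hmulx1 : forall x, hmul x hone = x;
  hmul0x : forall x, hmul hzero x = hzero;
  hmulx0 : forall x, hmul x hzero = hzero;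
  hmulDr : forall a x y, hmul a @` hadd x y = hadd (hmul a x) (hmul a y);
  hmulDl : forall a x y, (hmul^~ a) @` hadd x y = hadd (hmul x a) (hmul y a);
  hone_neq0 : hone <> hzero;
  hmul_inv : forall x, x <> hzero ->
    exists y, hmul x y = hone /\ hmul y x = hone;
}.

#[short(type="skewHyperfieldType")]
HB.structure Definition SkewHyperfield := {H of Choice H & isSkewHyperfield H}.

Notation "0" := (@hzero _) : hyper_scope.
Notation "x * y" := (hmul x y) : hyper_scope.
Notation "- x" := (hopp x) : hyper_scope.
Notation "x [+] y" := (hadd x y) (at level 50, left associativity) : hyper_scope.

Section HyperVectors.
Variables (H : skewHyperfieldType) (E : finType).
Local Open Scope hyper_scope.
Implicit Types X Y V W Z : {ffun E -> H}.

Definition hsetadd (A B : set H) : set H :=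
  \bigcup_(x in A) \bigcup_(y in B) (x [+] y).

Definition hdot X Y : set H :=
  \big[hsetadd/[set 0]]_(e : E) [set X e * Y e].

Definition orthogonal X Y : Prop := hdot X Y 0.

Definition vzero : {ffun E -> H} := [ffun=> 0].
Definition lscale (a : H) X : {ffun E -> H} := [ffun e => a * X e].
Definition rscale (a : H) X : {ffun E -> H} := [ffun e => X e * a].

Definition supp X : {set E} := [set e | X e != 0]%SET.
Definition supports (Q : set {ffun E -> H}) : set {set E} := supp @` Q.

Definition minsupp (Q : set {ffun E -> H}) : set {ffun E -> H} :=
  [set X | Q X /\ forall Y, Q Y -> ~ (supp Y \proper supp X)].

Definition modular_pair (C : set {ffun E -> H}) X Y : Prop :=
  supp X <> supp Y /\
  forall X' Y', C X' -> C Y' -> supp X' <> supp Y' ->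
    ~ (supp X' :|: supp Y' \proper supp X :|: supp Y)%SET.

(* [scale] is [lscale] for left and [rscale] for right matroids. *)
Record circuit_axioms (scale : H -> {ffun E -> H} -> {ffun E -> H})
    (C : set {ffun E -> H}) : Prop := CircuitAxioms {
  circuit_C0 : ~ C vzero;
  circuit_C1 : forall a X, a <> 0 -> C X -> C (scale a X);
  circuit_C2 : forall X Y, C X -> C Y -> supp X \subset supp Y ->
    exists2 a, a <> 0 & Y = scale a X;
  circuit_C3 : forall X Y e, C X -> C Y -> modular_pair C X Y ->
    X e = - Y e -> X e <> 0 ->
    exists Z, [/\ C Z, Z e = 0 & forall f, (X f [+] Y f) (Z f)];
}.

Record lmatroid := LMatroid {
  circuits : set {ffun E -> H};
  circuitsP : circuit_axioms lscale circuits }.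

Record rmatroid := RMatroid {
  rcircuits : set {ffun E -> H};
  rcircuitsP : circuit_axioms rscale rcircuits }.

(* Bases of the matroid on E whose circuits are the members of F. *)
Definition indep (F : set {set E}) (I : {set E}) : Prop :=
  forall C, F C -> ~ (C \subset I).
Definition basis (F : set {set E}) (B : {set E}) : Prop :=
  indep F B /\ forall I, indep F I -> B \subset I -> I = B.

Definition korthogonal (k : nat) (C D : set {ffun E -> H}) : Prop :=
  forall X Y, C X -> D Y -> #|supp X :&: supp Y|%SET <= k -> orthogonal X Y.

(* N is the dual of M: the underlying matroids are dual, i.e. their bases are
   complementary, and circuits of M and N meeting in at most three elements
   are orthogonal. *)
Definition is_dual (M : lmatroid) (N : rmatroid) : Prop :=
  (forall B : {set E}, basis (supports (circuits M)) B <->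
     basis (supports (rcircuits N)) (~: B)%SET) /\
  korthogonal 3 (circuits M) (rcircuits N).

(* Each M has exactly one dual; the union over all duals avoids choosing it. *)
Definition cocircuits (M : lmatroid) : set {ffun E -> H} :=
  \bigcup_(N in [set N | is_dual M N]) rcircuits N.

Definition vectors (M : lmatroid) : set {ffun E -> H} :=
  [set V | forall Y, cocircuits M Y -> orthogonal V Y].

End HyperVectors.

(* [None] is the zero element. *)
Definition Gmax {d : Order.disp_t} (G : orderedGroupType d) : Type := option G.

HB.instance Definition _ (d : Order.disp_t) (G : orderedGroupType d) :=
  Choice.on (Gmax G).

Section GmaxDef.
Variables (d : Order.disp_t) (G : orderedGroupType d).
Local Notation H := (Gmax G).
Implicit Types x y z t w : H.

Definition gmax_le x y : bool :=
  match x, y with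
  | None, _ => true
  | Some _, None => false
  | Some a, Some b => (a <= b)%O
  end.

Definition gmax_mul x y : H :=
  match x, y with
  | Some a, Some b => Some (a * b)%g
  | _, _ => None
  end.

Definition gmax_opp x : H := x.

Lemma gmax_le_anti : antisymmetric gmax_le.
Proof. by move=> [a|] [b|] //= /le_anti ->. Qed.

Lemma gmax_le_trans : transitive gmax_le.
Proof. by move=> [b|] [a|] [c|] //=; apply: le_trans. Qed.

Lemma gmax_le_total : total gmax_le.
Proof. by move=> [a|] [b|] //=; apply: le_total. Qed.

HB.instance Definition _ := Order.isOrder.Build d H
  (fun _ _ => erefl) (fun _ _ => erefl) (fun _ _ => erefl)
  gmax_le_anti gmax_le_trans gmax_le_total.

Definition gmax_add x y : set H :=
  if x == y then [set z : H | (z <= x)%O] else [set Order.max x y].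

Lemma gmax_le0x x : ((None : H) <= x)%O.
Proof. by []. Qed.

Lemma gmax_lex0 x : (x <= (None : H))%O -> x = None.
Proof. by case: x. Qed.

Lemma gmax_addP x y z : gmax_add x y z <->
  [/\ (z <= Order.max x y)%O, (x <= Order.max y z)%O & (y <= Order.max x z)%O].
Proof.
rewrite /gmax_add; case: (ltgtP x y) => [xy|yx|->] /=.
- rewrite (le_max _ x z) (le_max _ y z) (ltW xy) (leNgt y x) xy /=.
  split=> [->|[zy _ yz]]; first by rewrite lexx.
  by apply: le_anti; rewrite zy yz.
- rewrite (le_max _ x z) (le_max _ y z) (ltW yx) (leNgt x y) yx /=.
  split=> [->|[zx xz _]]; first by rewrite lexx.
  by apply: le_anti; rewrite zx xz.
- by rewrite !le_max lexx; split=> [->|[]].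
Qed.

Lemma gmax_addC x y : gmax_add x y = gmax_add y x.
Proof. by rewrite /gmax_add eq_sym maxC; case: eqVneq => // ->. Qed.

Lemma gmax_add_rot x y z : gmax_add x y z -> gmax_add z y x.
Proof.
move=> /gmax_addP[a b c]; apply/gmax_addP; split=> //.
- by rewrite maxC.
- by rewrite maxC.
- by rewrite maxC.
Qed.

Lemma gmax_add_neq0 x y : gmax_add x y !=set0.
Proof. by rewrite /gmax_add; case: eqP => _; [exists x => /= | eexists]. Qed.

Lemma gmax_addx0 x : gmax_add x None = [set x].
Proof.
rewrite /gmax_add; case: eqP => [->|_]; last by rewrite max_l ?gmax_le0x.
by apply/seteqP; split=> z /=; [apply: gmax_lex0 | move->].
Qed.

Lemma gmax_addN x y : gmax_add x y None <-> y = gmax_opp x.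
Proof.
rewrite gmax_addP /gmax_opp; split=> [[_]|->]; last by rewrite !le_max lexx.
rewrite !(max_l (gmax_le0x _)) => xy yx.
by apply: le_anti; rewrite xy yx.
Qed.

Lemma gmax_add_sub x y z w t : gmax_add y z t -> gmax_add x t w ->
  exists2 s, gmax_add x y s & gmax_add s z w.
Proof.
have [<-{y} xzt xtw|xy /gmax_addP[a b c] /gmax_addP[a' b' c']] := eqVneq x y.
  have [->|wz] := eqVneq w z.
    by exists None; [apply/gmax_addN | rewrite gmax_addC gmax_addx0].
  exists (Order.max w z); last first.
    by apply/gmax_add_rot; rewrite gmax_addC /gmax_add eq_sym (negPf wz) maxC.
  rewrite /gmax_add eqxx /= ge_max; have [zx|xz] := leP z x.
    move/gmax_addP: xzt => [a _ _]; move/gmax_addP: xtw => [b _ _].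
    by rewrite andbT (le_trans b)// ge_max lexx (le_trans a)// ge_max lexx.
  move: xzt; rewrite /gmax_add (lt_eqF xz) (max_r (ltW xz)) /= => tz.
  move: xtw; rewrite tz /gmax_add (lt_eqF xz) (max_r (ltW xz)) /= => wz'.
  by rewrite wz' eqxx in wz.
exists (Order.max x y); first by rewrite /gmax_add (negPf xy).
have lel (u v : H) : (u <= Order.max u v)%O by rewrite le_max lexx.
have ler (u v : H) : (v <= Order.max u v)%O by rewrite le_max lexx orbT.
apply/gmax_addP; split.
- apply: (le_trans a'); rewrite -maxA ge_max lel.
  by apply: (le_trans a); apply: ler.
- move: xy; rewrite neq_lt => /orP[xy|yx].
    rewrite (max_r (ltW xy)).
    have: (y <= Order.max z (Order.max x w))%O.
      by apply: (le_trans b); rewrite ge_max lel; apply: (le_trans c'); apply: ler.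
    by rewrite maxCA le_max leNgt xy.
  rewrite (max_l (ltW yx)).
  have: (x <= Order.max y (Order.max z w))%O.
    apply: (le_trans b'); rewrite maxA ge_max ler andbT.
    by apply: (le_trans a); apply: lel.
  by rewrite le_max leNgt yx.
- apply: (le_trans c); rewrite -maxA maxCA ge_max lel.
  by apply: (le_trans c'); apply: ler.
Qed.

Lemma gmax_addA x y z :
  \bigcup_(t in gmax_add y z) gmax_add x t =
  \bigcup_(t in gmax_add x y) gmax_add t z.
Proof.
apply/seteqP; split=> w [t].
  by move=> /gmax_add_sub h /h[s]; exists s.
rewrite gmax_addC (gmax_addC t) => /gmax_add_sub h /h[s].
by rewrite gmax_addC (gmax_addC s); exists s.
Qed.

Lemma gmax_add_rev x y z : gmax_add y z x -> gmax_add x (gmax_opp y) z.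
Proof. by rewrite gmax_addC => /gmax_add_rot. Qed.

Lemma gmax_mulA x y z : gmax_mul x (gmax_mul y z) = gmax_mul (gmax_mul x y) z.
Proof. by case: x y z => [a|] [b|] [c|] //=; rewrite mulgA. Qed.

Lemma gmax_mul1x x : gmax_mul (Some 1%g) x = x.
Proof. by case: x => [a|] //=; rewrite mul1g. Qed.

Lemma gmax_mulx1 x : gmax_mul x (Some 1%g) = x.
Proof. by case: x => [a|] //=; rewrite mulg1. Qed.

Lemma gmax_mulx0 x : gmax_mul x None = None.
Proof. by case: x. Qed.

Lemma gmax_mul_inv x : x <> None ->
  exists y, gmax_mul x y = Some 1%g /\ gmax_mul y x = Some 1%g.
Proof. by case: x => // a _; exists (Some a^-1%g); rewrite /= mulgV mulVg. Qed.

(* Both distributive laws at once: a monotone bijection fixing 0 commutes with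
   hyperaddition. *)
Lemma gmax_add_image (f g : H -> H) :
  {homo f : x y / (x <= y)%O} -> {homo g : x y / (x <= y)%O} ->
  cancel f g -> cancel g f ->
  forall x y, f @` gmax_add x y = gmax_add (f x) (f y).
Proof.
move=> fh gh fK gK.
have fmax x y : f (Order.max x y) = Order.max (f x) (f y).
  by case: (leP x y) => [xy|/ltW xy]; [rewrite max_r ?fh | rewrite max_l ?fh].
have gmax x y : g (Order.max x y) = Order.max (g x) (g y).
  by case: (leP x y) => [xy|/ltW xy]; [rewrite max_r ?gh | rewrite max_l ?gh].
move=> x y; apply/seteqP; split=> [_ [z /gmax_addP[a b c] <-]|z].
  by apply/gmax_addP; rewrite -!fmax; split; apply: fh.
move=> /gmax_addP[/gh a /gh b /gh c]; exists (g z); last exact: gK.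
by move: a b c; rewrite !gmax !fK => a b c; apply/gmax_addP.
Qed.

Lemma gmax_mull_homo a : {homo gmax_mul a : x y / (x <= y)%O}.
Proof. by case: a => [a|] [x|] [y|] //=; apply: lemul2l. Qed.

Lemma gmax_mulr_homo a : {homo gmax_mul^~ a : x y / (x <= y)%O}.
Proof. by case: a => [a|] [x|] [y|] //=; apply: lemul2r. Qed.

Lemma gmax_add_image0 x y :
  (fun=> None) @` gmax_add x y = gmax_add None None.
Proof.
rewrite gmax_addx0; apply/seteqP; split=> z /=; first by case=> t _ <-.
by move=> ->; have [t xyt] := gmax_add_neq0 x y; exists t.
Qed.

Lemma gmax_mulDr a x y :
  gmax_mul a @` gmax_add x y = gmax_add (gmax_mul a x) (gmax_mul a y).
Proof.
case: a => [a|]; last exact: gmax_add_image0.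
apply: (@gmax_add_image _ (gmax_mul (Some a^-1%g))) => [||z|z];
  try exact: gmax_mull_homo.
- by case: z => [z|] //=; rewrite mulgA mulVg mul1g.
- by case: z => [z|] //=; rewrite mulgA mulgV mul1g.
Qed.

Lemma gmax_mulDl a x y :
  (gmax_mul^~ a) @` gmax_add x y = gmax_add (gmax_mul x a) (gmax_mul y a).
Proof.
case: a => [a|].
  apply: (@gmax_add_image _ (gmax_mul^~ (Some a^-1%g))) => [||z|z];
    try exact: gmax_mulr_homo.
  - by case: z => [z|] //=; rewrite -mulgA mulgV mulg1.
  - by case: z => [z|] //=; rewrite -mulgA mulVg mulg1.
rewrite !gmax_mulx0 -(gmax_add_image0 x y).
by apply: eq_imagel => z _; rewrite gmax_mulx0.
Qed.

Lemma gmax_one_neq0 : (Some 1%g : H) <> None.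
Proof. by []. Qed.

HB.instance Definition _ := isSkewHyperfield.Build H
  gmax_add_neq0 gmax_addC gmax_addA gmax_addx0 gmax_addN gmax_add_rev
  gmax_mulA gmax_mul1x gmax_mulx1 (fun=> erefl) gmax_mulx0
  gmax_mulDr gmax_mulDl gmax_one_neq0 gmax_mul_inv.

Definition vcomp (E : finType) (V W : {ffun E -> H}) : {ffun E -> H} :=
  [ffun e => Order.max (V e) (W e)].

End GmaxDef.

(* Main.v *)
Require Import Defs.
From HB Require Import structures.
From mathcomp Require Import all_boot all_order.
From mathcomp Require Import monoid.
From mathcomp Require Import boolp classical_sets.

Set Implicit Arguments.
Unset Strict Implicit.
Unset Printing Implicit Defensive.

Import Order.TTheory.

Local Open Scope classical_set_scope.
Local Open Scope order_scope.
Local Open Scope hyper_scope.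

(* A matroid M with circuits C determines the set S of componentwise maxima of
   circuits and the set T of all Y orthogonal to every circuit; the point is
   that S and T are each other's orthogonal complement, satisfy (V0)-(V3) on
   their side, and that Min(T \ 0) is the set of cocircuits.

   The only combinatorial input is a painting property: for f outside A,
   either some circuit X satisfies f \in X \subset A + f, or some Y in T
   satisfies Y_f = 1 and vanishes on A. Here Y is supported on a cocircuit D and
   its ratios Y_e / Y_g are read off from the circuits meeting D in {e, g}. If
   a circuit X were not orthogonal to Y, with the maximum of the X_g Y_g
   attained only at c, then modular elimination of X against a rescaled circuit
   avoiding c, below X on D (up to a base point e), would give a circuit with
   the same defect and a smaller intersection with D - e.

   Painting extends to a Farkas lemma with arbitrary bounds on the coordinates,
   by trading a bounded coordinate for the two extreme cases "zero" and
   "unbounded". Elimination for S and T and S = T^perp are instances of it.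
   Conversely, if (V0)-(V3) hold for a set Q, then Min(Q \ 0) satisfies the
   circuit axioms and its componentwise maxima are exactly Q. *)

(** * Arithmetic and orthogonality in the max hyperfield *)

Section GmaxArithmetic.
Variables (d : Order.disp_t) (G : orderedGroupType d).
Local Notation H := (Gmax G).
Local Notation "0" := (hzero : H) : hyper_scope.
Local Notation "1" := (hone : H) : hyper_scope.
Implicit Types a x y z : H.

Definition ginv x : H := if x is Some a then Some a^-1%g else None.

Lemma gmax_ge0 x : 0 <= x.
Proof. exact: gmax_le0x. Qed.

Lemma gmax_le0 x : (x <= 0) = (x == 0).
Proof. by apply/idP/eqP => [/gmax_lex0|->]. Qed.

Lemma gmax_gt0 x : (0 < x) = (x != 0).
Proof. by rewrite ltNge gmax_le0. Qed.

Lemma ginv_neq0 x : x != 0 -> ginv x != 0.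
Proof. by case: x. Qed.

Lemma gmulV x : x != 0 -> x * ginv x = 1.
Proof. by case: x => // a _; congr Some; rewrite mulgV. Qed.

Lemma gmulVx x : x != 0 -> ginv x * x = 1.
Proof. by case: x => // a _; congr Some; rewrite mulVg. Qed.

Lemma gmul_eq0 x y : (x * y == 0) = (x == 0) || (y == 0).
Proof. by case: x => [a|]; case: y. Qed.

Lemma gmulKl a x y : a != 0 -> a * x = a * y -> x = y.
Proof.
by move=> a0 /(congr1 (fun t => ginv a * t)); rewrite !hmulA gmulVx// !hmul1x.
Qed.

Lemma gmulKr a x y : a != 0 -> x * a = y * a -> x = y.
Proof.
by move=> a0 /(congr1 (fun t => t * ginv a)); rewrite -!hmulA gmulV// !hmulx1.
Qed.

Lemma gmul_le a x y : x <= y -> a * x <= a * y.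
Proof. exact: gmax_mull_homo. Qed.

Lemma gmul_ler a x y : x <= y -> x * a <= y * a.
Proof. exact: (@gmax_mulr_homo _ _ a). Qed.

Lemma gmul_lt a x y : a != 0 -> x < y -> a * x < a * y.
Proof.
move=> a0 xy; rewrite lt_neqAle gmul_le ?(ltW xy)// andbT.
by apply/eqP => /(gmulKl a0) e; rewrite e ltxx in xy.
Qed.

Lemma gmul_ltr a x y : a != 0 -> x < y -> x * a < y * a.
Proof.
move=> a0 xy; rewrite lt_neqAle gmul_ler ?(ltW xy)// andbT.
by apply/eqP => /(gmulKr a0) e; rewrite e ltxx in xy.
Qed.

Lemma gadd_le x y z : (x [+] y) z -> z <= Order.max x y.
Proof. by move=> /gmax_addP[]. Qed.

Lemma gadd_neq x y z : (x [+] y) z -> x <> y -> z = Order.max x y.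
Proof. by rewrite /hadd /= /gmax_add => + /eqP/negPf e; rewrite e. Qed.

Lemma gadd_lt x y z : (x [+] y) z -> y < x -> z = x.
Proof.
move=> h yx; rewrite (gadd_neq h) ?(max_l (ltW yx))//.
by move=> e; rewrite e ltxx in yx.
Qed.

Variable E : finType.
Implicit Types (X Y V W Z : {ffun E -> H}).

Lemma in_supp X e : (e \in supp X) = (X e != 0).
Proof. by rewrite inE. Qed.

(** At [z = 0] the right-hand side says that a nonzero maximum of the terms is attained at least
    twice. General [z] is needed because the induction removes one term and must describe every
    element of the remaining hypersum. *)
Lemma hdotP (p : E -> H) (r : seq E) z : uniq r ->
  (\big[@hsetadd H/[set 0]]_(e <- r) [set p e]) z <->
  (z != 0 -> exists2 g, g \in r & z <= p g) /\
  (forall e, e \in r -> p e <= z \/ exists g, [/\ g \in r, g != e & p e <= p g]).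
Proof.
elim: r z => [|e0 r IH] z /=.
  move=> _; rewrite big_nil; split=> [->|[h _]]; first by rewrite eqxx; split.
  by have [//|/h[]] := eqVneq z 0.
move=> /andP[e0r ur]; rewrite big_cons.
have -> : hsetadd [set p e0] (\big[@hsetadd H/[set 0]]_(e <- r) [set p e]) z <->
   exists2 y, (\big[@hsetadd H/[set 0]]_(e <- r) [set p e]) y & (p e0 [+] y) z.
  split=> [[x -> [y hy hz]]|[y hy hz]]; first by exists y.
  by exists (p e0) => //; exists y.
split=> [[y /(IH _ ur)[y1 y2]] /gmax_addP[z1 z2 z3]|[z1 z2]].
  have yr : y = 0 \/ exists2 g, g \in r & y <= p g.
    by have [->|/y1] := eqVneq y 0; [left|right].
  split=> [z0|e].
    move: z1; rewrite le_max => /orP[z1|z1]; first by exists e0; rewrite ?mem_head.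
    case: yr => [y0|[g gr gy]]; last first.
      by exists g; [rewrite inE gr orbT | exact: le_trans gy].
    by move: z1 z0; rewrite y0 gmax_le0 => ->.
  rewrite inE => /orP[/eqP->|er].
    move: z2; rewrite le_max => /orP[z2|]; last by left.
    case: yr => [y0|[g gr gy]].
      by left; move: z2; rewrite y0 gmax_le0 => /eqP ->; exact: gmax_ge0.
    right; exists g; split; [by rewrite inE gr orbT| | exact: le_trans gy].
    by apply: contraNneq e0r => <-.
  case: (y2 e er) => [ey|[g [gr ge pg]]]; last first.
    by right; exists g; rewrite inE gr orbT.
  move: z3; rewrite le_max => /orP[z3|z3]; last by left; exact: le_trans z3.
  right; exists e0; rewrite mem_head (le_trans ey z3); split=> //.
  by apply: contraNneq e0r => ->.
(* The tail must supply some y with z in p e0 [+] y. If z = p e0, any y <= z will do: z itself when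
   a tail term reaches it, and otherwise the maximum of the tail. If z differs from p e0,
   reversibility forces y to be their maximum. *)
have [ze|ze] := eqVneq z (p e0).
  have [[g gr zg]|nz] := pselect (exists2 g, g \in r & z <= p g).
    exists z; last by rewrite ze; apply/gmax_addP; rewrite !le_max lexx.
    apply/(IH _ ur); split=> [_|e er]; first by exists g.
    have [|ez|[h [hr he hp]]] := z2 e; first by rewrite inE er orbT.
      by left.
    move: hr; rewrite inE => /orP[/eqP hr|hr]; last by right; exists h.
    by left; rewrite ze -hr.
  exists (\big[Order.max/0]_(g <- r) p g).
    apply/(IH _ ur); split=> [|e er].
      elim: (r) => [|g s IHs]; first by rewrite big_nil eqxx.
      rewrite big_cons; case: leP => [_ /IHs[h hs hp]|_ _].
        by exists h; rewrite ?inE ?hs ?orbT.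
      by exists g; rewrite ?mem_head.
    left; elim: (r) er => // g s IHs; rewrite inE big_cons le_max.
    by move=> /orP[/eqP->|/IHs->]; rewrite ?lexx ?orbT.
  have le : \big[Order.max/0]_(g <- r) p g <= z.
    rewrite big_seq; elim/big_ind: _ => [|x y xz yz|g gr]; first exact: gmax_ge0.
      by rewrite ge_max xz yz.
    by have [//|/ltW zg] := leP (p g) z; case: nz; exists g.
  by rewrite ze; apply/gmax_addP; rewrite !le_max lexx !orbT -ze le.
exists (Order.max z (p e0)).
  apply/(IH _ ur); split=> [y0|e er].
    have [zp|pz] := leP z (p e0).
      have [||[g [gr ge pg]]] := z2 e0; first by rewrite mem_head.
        by move=> pz; case/eqP: ze; apply: le_anti; rewrite zp pz.
      exists g => //; by move: gr; rewrite inE (negPf ge).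
    have z0 : z != 0 by rewrite -gmax_gt0 (le_lt_trans _ pz)// gmax_ge0.
    have [g] := z1 z0.
    rewrite inE => /orP[/eqP ->|gr zg]; first by rewrite leNgt pz.
    by exists g.
  have [|ez|[h [hr he hp]]] := z2 e; first by rewrite inE er orbT.
    by left; rewrite le_max ez.
  move: hr; rewrite inE => /orP[/eqP hr|hr]; last by right; exists h.
  by left; rewrite le_max -hr hp orbT.
apply/gmax_addP; split.
- by rewrite !le_max lexx orbT.
- by rewrite !le_max lexx !orbT.
- by rewrite maxC.
Qed.

Lemma orthP X Y : orthogonal X Y <->
  forall e, X e * Y e != 0 -> exists2 g, g != e & X e * Y e <= X g * Y g.
Proof.
rewrite /orthogonal /hdot (hdotP _ _ (index_enum_uniq E)).
split=> [[_ h] e p0|h].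
  have [|le0|[g [_ ge pg]]] := h e; first exact: mem_index_enum.
    by move: le0 p0; rewrite gmax_le0 => /eqP->; rewrite eqxx.
  by exists g.
split=> [|e _]; first by rewrite eqxx.
have [->|/h[g ge pg]] := eqVneq (X e * Y e) 0; first by left.
by right; exists g; rewrite mem_index_enum.
Qed.

Lemma orthPn X Y : ~ orthogonal X Y ->
  exists2 c, X c * Y c != 0 & forall g, g != c -> X g * Y g < X c * Y c.
Proof.
move=> n; apply: contrapT => h; apply: n; apply/orthP => e e0.
apply: contrapT => n; apply: h; exists e => // g ge.
by rewrite ltNge; apply/negP => le; apply: n; exists g.
Qed.

End GmaxArithmetic.

(** * Circuit elimination and cocircuits for set systems *)

Section SetCircuits.
Variables (E : finType) (F : set {set E}).
Local Open Scope set_scope.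
Implicit Types (P Q R W D A : {set E}).

Definition modular_sets P Q : Prop := P <> Q /\
  forall P' Q', F P' -> F Q' -> P' <> Q' -> ~ P' :|: Q' \proper P :|: Q.

Hypothesis antichain : forall P Q, F P -> F Q -> P \subset Q -> P = Q.
Hypothesis modular_elim : forall P Q e, F P -> F Q -> modular_sets P Q ->
  e \in P -> e \in Q -> exists2 R, F R & R \subset (P :|: Q) :\ e.

Lemma proper_of_mem (T : finType) (A B : {set T}) x :
  A \subset B -> x \in B -> x \notin A -> A \proper B.
Proof. by move=> AB xB xA; apply/fintype.properP; split=> //; exists x. Qed.

Lemma not_modular P Q : P <> Q -> ~ modular_sets P Q -> exists P' Q',
  [/\ F P', F Q', P' <> Q' & P' :|: Q' \proper P :|: Q].
Proof.
move=> PQ nm; apply: contrapT => h; apply: nm; split=> // P' Q' FP' FQ' PQ' lt.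
by apply: h; exists P', Q'.
Qed.

Lemma antichain_diff P Q : F P -> F Q -> P <> Q -> exists2 x, x \in P & x \notin Q.
Proof.
move=> FP FQ PQ; apply/fintype.subsetPn/negP => sPQ.
by apply: PQ; apply: antichain.
Qed.

(** Induction on the size of the union: a pair that is not modular has a competing pair with smaller
    union, and either one of its members already avoids e or the induction applies to it. *)
Lemma weak_elim P Q e : F P -> F Q -> P <> Q -> e \in P -> e \in Q ->
  exists2 R, F R & R \subset (P :|: Q) :\ e.
Proof.
have [n] := ubnP #|P :|: Q|; elim: n P Q => // n IH P Q /[!ltnS] ltn FP FQ PQ eP eQ.
have [m|m] := pselect (modular_sets P Q); first exact: modular_elim.
have [P' [Q' [FP' FQ' PQ' lt]]] := not_modular PQ m.
have sub := fintype.proper_sub lt.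
have [eP'|eP'] := boolP (e \in P'); last first.
  exists P' => //; rewrite finset.subsetD1 eP' andbT.
  by apply: fintype.subset_trans sub; exact: finset.subsetUl.
have [eQ'|eQ'] := boolP (e \in Q'); last first.
  exists Q' => //; rewrite finset.subsetD1 eQ' andbT.
  by apply: fintype.subset_trans sub; exact: finset.subsetUr.
have [|R FR sR] := IH P' Q' _ FP' FQ' PQ' eP' eQ'.
  by apply: leq_trans ltn; exact: fintype.proper_card.
by exists R => //; apply: fintype.subset_trans sR _; exact: finset.setSD.
Qed.

(** If weak elimination gives an R that loses f, some g lies in R and Q but not in P. Eliminating g
    from Q and R while keeping e gives W, and eliminating e from P and W keeps f. The first union
    misses f and the second misses g, so both are smaller than P :|: Q. *)
Lemma strong_elim P Q e f : F P -> F Q -> e \in P -> e \in Q ->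
  f \in P -> f \notin Q ->
  exists R, [/\ F R, f \in R & R \subset (P :|: Q) :\ e].
Proof.
have [n] := ubnP #|P :|: Q|.
elim: n P Q e f => // n IH P Q e f /[!ltnS] ltn FP FQ eP eQ fP fQ.
have PQ : P <> Q by move=> PQ; rewrite -PQ fP in fQ.
have [R FR] := weak_elim FP FQ PQ eP eQ.
rewrite finset.subsetD1 => /andP[sR eR].
have [fR|fR] := boolP (f \in R).
  by exists R; split=> //; rewrite finset.subsetD1 sR.
have [|g gR gP] := antichain_diff FR FP; first by move=> RP; rewrite RP fP in fR.
have gQ : g \in Q by have := fintype.subsetP sR g gR; rewrite inE (negPf gP).
have sQR : Q :|: R \subset P :|: Q by rewrite finset.subUset finset.subsetUr.
have [|W [FW eW]] := IH Q R g e _ FQ FR gQ gR eQ eR.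
  apply: leq_trans ltn; apply: fintype.proper_card.
  by apply: (proper_of_mem (x := f)) => //; rewrite !inE ?fP// negb_or fQ.
rewrite finset.subsetD1 => /andP[sW gW].
have fW : f \notin W.
  by apply: contraNN fQ => /(fintype.subsetP sW); rewrite inE (negPf fR) orbF.
have sPW : P :|: W \subset P :|: Q.
  by rewrite finset.subUset finset.subsetUl (fintype.subset_trans sW).
have [|R' [FR' fR' sR']] := IH P W e f _ FP FW eP eW fP fW.
  apply: leq_trans ltn; apply: fintype.proper_card.
  by apply: (proper_of_mem (x := g)) => //; rewrite !inE ?gQ ?orbT// negb_or gP.
exists R'; split=> //; apply: fintype.subset_trans sR' _; exact: finset.setSD.
Qed.

(** A competing pair misses some z of the union. If z is not in P, a member of that pair other than
    P serves with j = z. If z is in P, every circuit avoiding z differs from P, and any j of Q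
    outside P can be eliminated from the pair. *)
Lemma nonmodular_circuit P Q : F P -> F Q -> P <> Q -> ~ modular_sets P Q ->
  exists R j, [/\ F R, R <> P, j \in Q, j \notin P & R \subset (P :|: Q) :\ j].
Proof.
move=> FP FQ PQ nm; have [P' [Q' [FP' FQ' PQ' lt]]] := not_modular PQ nm.
have /fintype.properP[sub [z zPQ zPQ']] := lt.
have [sP' sQ'] : P' \subset P :|: Q /\ Q' \subset P :|: Q.
  by move: sub; rewrite finset.subUset => /andP[].
have [zP' zQ'] : z \notin P' /\ z \notin Q'.
  by move: zPQ'; rewrite inE negb_or => /andP[].
have [zP|zP] := boolP (z \in P); last first.
  have zQ : z \in Q by move: zPQ; rewrite inE (negPf zP).
  have [P'P|P'P] := pselect (P' = P); last first.
    by exists P', z; split=> //; rewrite finset.subsetD1 sP'.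
  exists Q', z; split=> //; first by rewrite -P'P => /esym.
  by rewrite finset.subsetD1 sQ'.
have nP R : z \notin R -> R <> P by move=> zR RP; rewrite RP zP in zR.
have [|j jQ jP] := antichain_diff FQ FP; first by move/esym.
have [jP'|jP'] := boolP (j \in P'); last first.
  by exists P', j; split=> //; [exact: nP|rewrite finset.subsetD1 sP'].
have [jQ'|jQ'] := boolP (j \in Q'); last first.
  by exists Q', j; split=> //; [exact: nP|rewrite finset.subsetD1 sQ'].
have [R FR sR] := weak_elim FP' FQ' PQ' jP' jQ'.
exists R, j; split=> //; last exact: fintype.subset_trans (finset.setSD _ sub).
apply: nP; apply: contraNN zPQ' => /(fintype.subsetP sR).
by rewrite inE => /andP[].
Qed.

(* A choice of W with P :|: W smallest is modular with P: otherwise a circuit R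
   not containing x and with P :|: R smaller either meets D, or can be used to
   shrink W by strong elimination without leaving D. *)
Lemma modular_avoiding P W0 D x : F P -> F W0 -> x \in P -> x \notin W0 ->
  W0 :&: D != finset.set0 -> exists W, [/\ F W, modular_sets P W, x \notin W,
    W :&: D != finset.set0 & W \subset P :|: W0].
Proof.
have [n] := ubnP #|P :|: W0|; elim: n W0 => // n IH W /[!ltnS] ltn FP FW xP xW WD.
have [m|nm] := pselect (modular_sets P W).
  by exists W; split=> //; exact: finset.subsetUr.
have PW : P <> W by move=> PW; rewrite -PW xP in xW.
have step W' : F W' -> x \notin W' -> W' :&: D != finset.set0 -> W' \subset P :|: W ->
    (exists i, [/\ i \in W, i \notin P & i \notin W']) ->
    exists V, [/\ F V, modular_sets P V, x \notin V,
      V :&: D != finset.set0 & V \subset P :|: W].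
  move=> FW' xW' W'D sW' [i [iW iP iW']].
  have sPW : P :|: W' \subset P :|: W by rewrite finset.subUset finset.subsetUl.
  have [|V [FV mV xV VD sV]] := IH W' _ FP FW' xP xW' W'D; last first.
    by exists V; split=> //; exact: fintype.subset_trans sPW.
  apply: leq_trans ltn; apply: fintype.proper_card.
  apply: (proper_of_mem (x := i)) => //; rewrite !inE ?iW ?orbT//.
  by rewrite negb_or iP.
have [R [j [FR xR jR jP [jW sR]]]] : exists R j, [/\ F R, x \notin R, j \notin R,
    j \notin P & j \in W /\ R \subset P :|: W].
  have [R [j [FR RP jW jP]]] := nonmodular_circuit FP FW PW nm.
  rewrite finset.subsetD1 => /andP[sR jR].
  have [xR|xR] := boolP (x \in R); last by exists R, j.
  have [R' FR'] := weak_elim FP FR (nesym RP) xP xR.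
  rewrite finset.subsetD1 => /andP[sR' xR'].
  have sPR : P :|: R \subset P :|: W by rewrite finset.subUset finset.subsetUl.
  exists R', j; split=> //; last by split=> //; exact: fintype.subset_trans sPR.
  apply: contraNN jR => /(fintype.subsetP sR').
  by rewrite inE (negPf jP).
have [RD|RD] := eqVneq (R :&: D) finset.set0; last first.
  by apply: (step R) => //; exists j.
have [|i iR iP] := antichain_diff FR FP; first by move=> RP; rewrite RP xP in xR.
have iW : i \in W by have := fintype.subsetP sR i iR; rewrite inE (negPf iP).
have /finset.set0Pn[w] := WD; rewrite inE => /andP[wW wD].
have wR : w \notin R.
  apply/negP => wR; have : w \in R :&: D by rewrite inE wR.
  by rewrite RD inE.
have [W' [FW' wW']] := strong_elim FW FR iW iR wW wR.
rewrite finset.subsetD1 => /andP[sW' iW'].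
apply: (step W') => //; last by exists i.
- apply: contraNN xW => /(fintype.subsetP sW').
  by rewrite inE (negPf xR) orbF.
- by apply/finset.set0Pn; exists w; rewrite inE wW'.
- by apply: fintype.subset_trans sW' _; rewrite finset.subUset finset.subsetUr.
Qed.

(** When F is the family of circuits of a matroid, these sets are the unions of cocircuits. *)
Definition no_single_meet D : Prop := forall P, F P -> #|P :&: D| <> 1%N.

Lemma no_single_meetP D P g : no_single_meet D -> F P -> g \in P -> g \in D ->
  exists h, [/\ h \in P, h \in D & h != g].
Proof.
move=> nD FP gP gD; apply: contrapT => h; apply: (nD P FP).
apply/eqP/cards1P; exists g; apply/setP => y; rewrite !inE.
apply/andP/eqP => [[yP yD]|->//].
by apply/eqP/negP => /negP yg; apply: h; exists y.
Qed.

Lemma meet_pair D P e g : no_single_meet D -> F P ->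
  P :&: D \subset [set e; g]%SET -> e \in D -> g \in D -> P :&: D != finset.set0 ->
  e \in P /\ g \in P.
Proof.
move=> nD FP sP eD gD /finset.set0Pn[x]; rewrite inE => /andP[xP xD].
have [y [yP yD yx]] := no_single_meetP nD FP xP xD.
have : x \in P :&: D by rewrite inE xP.
have : y \in P :&: D by rewrite inE yP.
move=> /(fintype.subsetP sP) + /(fintype.subsetP sP); rewrite !inE.
move=> /orP[]/eqP yE /orP[]/eqP xE;
  by move: yx xP yP; rewrite yE xE ?eqxx.
Qed.

(** Lets two circuits with the same trace on D be compared through a third by induction on the
    union. A circuit R missing some z in P and some j in Q is found first; if it also misses D,
    eliminating between Q and R while keeping e restores the trace. *)
Lemma modular_bridge D P Q e g : no_single_meet D -> F P -> F Q ->
  P <> Q -> ~ modular_sets P Q ->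
  e != g -> P :&: D = [set e; g]%SET -> Q :&: D = [set e; g]%SET ->
  exists R, [/\ F R, R :&: D = [set e; g]%SET, P :|: R \proper P :|: Q &
                R :|: Q \proper P :|: Q].
Proof.
move=> nD FP FQ PQ nm eg PD QD.
have [[eP eD] [gP gD]] : (e \in P /\ e \in D) /\ (g \in P /\ g \in D).
  have : e \in P :&: D by rewrite PD !inE eqxx.
  have : g \in P :&: D by rewrite PD !inE eqxx orbT.
  by rewrite !inE => /andP[-> ->] /andP[-> ->].
have eQ : e \in Q.
  by have : e \in Q :&: D; [rewrite QD !inE eqxx | rewrite inE => /andP[]].
have sPQ R : R \subset P :|: Q -> R :&: D \subset [set e; g]%SET.
  move=> sR; apply: fintype.subset_trans (finset.setSI _ sR) _.
  by rewrite finset.setIUl PD QD finset.setUid.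
have full R : F R -> R \subset P :|: Q -> R :&: D != finset.set0 ->
    R :&: D = [set e; g]%SET.
  move=> FR sR R0; have [eR gR] := meet_pair nD FR (sPQ R sR) eD gD R0.
  apply/eqP; rewrite finset.eqEsubset sPQ//=; apply/fintype.subsetP => y.
  by rewrite !inE => /orP[]/eqP->; apply/andP.
have [R [z [j [FR [zP zQ zR] [jQ jP jR] sR]]]] : exists R z j, [/\ F R,
    [/\ z \in P, z \notin Q & z \notin R],
    [/\ j \in Q, j \notin P & j \notin R] & R \subset P :|: Q].
  have [R [j [FR RP jQ jP]]] := nonmodular_circuit FP FQ PQ nm.
  rewrite finset.subsetD1 => /andP[sR jR].
  have [z zP zQ] := antichain_diff FP FQ PQ.
  have [zR|zR] := boolP (z \in R); last by exists R, z, j.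
  have [R' FR'] := weak_elim FP FR (nesym RP) zP zR.
  rewrite finset.subsetD1 => /andP[sR' zR'].
  exists R', z, j; split=> //.
    split=> //; apply: contraNN jR => /(fintype.subsetP sR').
    by rewrite inE (negPf jP).
  by apply: fintype.subset_trans sR' _; rewrite finset.subUset finset.subsetUl.
have bridge S i : F S -> S \subset P :|: Q -> S :&: D != finset.set0 ->
    z \notin S -> i \in Q -> i \notin P -> i \notin S ->
    [/\ F S, S :&: D = [set e; g]%SET, P :|: S \proper P :|: Q &
                S :|: Q \proper P :|: Q].
  move=> FS sS SD zS iQ iP iS; split=> //; first exact: full.
    apply: (proper_of_mem (x := i)); rewrite ?finset.subUset ?finset.subsetUl//.
      by rewrite !inE iQ orbT.
    by rewrite !inE negb_or iP.
  apply: (proper_of_mem (x := z)); rewrite ?finset.subUset ?finset.subsetUr ?andbT//.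
    by rewrite !inE zP.
  by rewrite !inE negb_or zS.
have [RD|RD] := eqVneq (R :&: D) finset.set0; last first.
  by exists R; apply: (bridge R j).
have eR : e \notin R.
  apply/negP => eR; have : e \in R :&: D by rewrite inE eR.
  by rewrite RD inE.
have [|i iR iP] := antichain_diff FR FP; first by move=> RP; rewrite RP eP in eR.
have iQ : i \in Q by have := fintype.subsetP sR i iR; rewrite inE (negPf iP).
have [S [FS eS]] := strong_elim FQ FR iQ iR eQ eR.
rewrite finset.subsetD1 => /andP[sS iS].
exists S; apply: (bridge S i) => //.
- by apply: fintype.subset_trans sS _; rewrite finset.subUset finset.subsetUr.
- by apply/finset.set0Pn; exists e; rewrite inE eS.
- apply/negP => /(fintype.subsetP sS).
  by rewrite inE (negPf zQ) (negPf zR).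
Qed.

(** A maximal B containing A and not spanning f is a hyperplane, and D is its complement, a
    cocircuit through f. The circuits meeting D in a pair witness that B with any further element
    does span f. *)
Lemma cocircuit_exists f A : f \notin A ->
  (forall P, F P -> f \in P -> ~ P \subset f |: A) ->
  exists D, [/\ f \in D, D \subset ~: A, no_single_meet D &
    forall g h, g \in D -> h \in D -> g != h ->
      exists2 P, F P & P :&: D = [set g; h]%SET].
Proof.
move=> fA nA.
pose good (B : {set E}) := `[< f \notin B /\
  forall P, F P -> f \in P -> ~ P \subset f |: B >].
have [B /maxsetP[/asboolP[fB nB] mB] AB] : exists2 B, maxset good B & A \subset B.
  have [|B mB AB] := @maxset_exists _ good A; first by apply/asboolP.
  by exists B.
(* By maximality, adding g to B creates a circuit Q through f and g. Eliminating g between Q and P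
   would leave a circuit through f inside f + B. *)
have sing P g : F P -> g \in P -> g \notin B -> ~ P \subset g |: B.
  have [->|gf] := eqVneq g f; first by move=> ? ? ?; exact: nB.
  move=> FP gP gB sP.
  have : ~ good (g |: B).
    move=> /mB /(_ (finset.subsetUr _ _)) gBB.
    by rewrite -gBB !inE eqxx in gB.
  apply; apply/asboolP; split=> [|Q FQ fQ sQ].
    by rewrite !inE negb_or eq_sym gf.
  have gQ : g \in Q.
    apply/negP => /negP gQ; apply: (nB Q FQ fQ).
    apply/fintype.subsetP => y yQ; have := fintype.subsetP sQ y yQ.
    rewrite !inE; have [yg|_] //= := eqVneq y g.
    by rewrite -yg yQ in gQ.
  have fP : f \notin P.
    apply/negP => /(fintype.subsetP sP).
    by rewrite !inE eq_sym (negPf gf) (negPf fB).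
  have [R [FR fR sR]] := strong_elim FQ FP gQ gP fQ fP.
  apply: (nB R FR fR); apply/fintype.subsetP => y /(fintype.subsetP sR).
  rewrite !inE => /andP[yg] /orP[/(fintype.subsetP sQ)|/(fintype.subsetP sP)].
    by rewrite !inE (negPf yg).
  by rewrite !inE (negPf yg) /= => ->; rewrite orbT.
have nD : no_single_meet (~: B).
  move=> P FP /eqP/cards1P[g gE].
  have : g \in P :&: ~: B by rewrite gE inE.
  rewrite !inE => /andP[gP gB]; apply: (sing P g) => //.
  apply/fintype.subsetP => y yP; rewrite !inE.
  have [->//|yg/=] := eqVneq y g; apply: contraTT yg => yB.
  by have : y \in P :&: ~: B; [rewrite !inE yP | rewrite gE inE negbK].
have pairf g : g \notin B -> g != f -> exists2 P, F P & P :&: ~: B = [set f; g]%SET.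
  move=> gB gf.
  have : ~ good (g |: B).
    move=> /mB /(_ (finset.subsetUr _ _)) gBB.
    by rewrite -gBB !inE eqxx in gB.
  move=> ng; apply: contrapT => h; apply: ng; apply/asboolP; split.
    by rewrite !inE negb_or eq_sym gf.
  move=> P FP fP sP; apply: h; exists P => //.
  have sPD : P :&: ~: B \subset [set f; g]%SET.
    apply/fintype.subsetP => y; rewrite !inE => /andP[/(fintype.subsetP sP)].
    by rewrite !inE orbA => /orP[|->].
  have [|||fP' gP] := meet_pair nD FP sPD; rewrite ?inE//.
    by apply/finset.set0Pn; exists f; rewrite !inE fP.
  apply/eqP; rewrite finset.eqEsubset sPD; apply/fintype.subsetP => y.
  by rewrite !inE => /orP[]/eqP->; apply/andP.
exists (~: B); split=> //; first by rewrite inE.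
  by rewrite finset.setCS.
move=> g h; rewrite !inE => gB hB gh.
have [hf|hf] := eqVneq h f.
  by rewrite hf finset.setUC; apply: pairf => //; rewrite -hf.
have [gf|gf] := eqVneq g f; first by rewrite gf; apply: pairf.
(* With both g and h different from f, eliminating f between the circuits for {f, g} and {f, h}
   leaves only g and h in D. *)
have [P FP PD] := pairf g gB gf; have [Q FQ QD] := pairf h hB hf.
have memP y : y \notin B -> (y \in P) = (y == f) || (y == g).
  by move=> yB; move/setP/(_ y): PD; rewrite !inE yB andbT.
have memQ y : y \notin B -> (y \in Q) = (y == f) || (y == h).
  by move=> yB; move/setP/(_ y): QD; rewrite !inE yB andbT.
have [||||R [FR gR sR]] := @strong_elim P Q f g FP FQ;
  rewrite ?memP ?memQ ?eqxx ?orbT//.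
  by rewrite negb_or gf.
exists R => //.
have sRD : R :&: ~: B \subset [set g; h]%SET.
  apply/fintype.subsetP => y; rewrite !inE => /andP[/(fintype.subsetP sR)].
  rewrite !inE => /andP[yf] PQ yB; move: PQ; rewrite memP// memQ// (negPf yf).
  by [].
have [|||gR' hR] := meet_pair nD FR sRD; rewrite ?inE//.
  by apply/finset.set0Pn; exists g; rewrite !inE gR.
apply/eqP; rewrite finset.eqEsubset sRD; apply/fintype.subsetP => y.
by rewrite !inE => /orP[]/eqP->; apply/andP.
Qed.

End SetCircuits.

(** * From circuits with coefficients to the painting property *)

Section ValuatedCircuits.
Variables (d : Order.disp_t) (G : orderedGroupType d) (E : finType).
Local Notation H := (Gmax G).
Local Notation vec := {ffun E -> H}.
Local Notation "0" := (hzero : H) : hyper_scope.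
Local Notation "1" := (hone : H) : hyper_scope.
Implicit Types (X Y V W Z : vec) (P Q R : {set E}).

(* The common properties of left and right multiplication [m a x] of x by a. *)
Record scaling (m : H -> H -> H) : Prop := Scaling {
  scaling_x0 : forall a, m a 0 = 0;
  scaling_neq0 : forall a x, a != 0 -> x != 0 -> m a x != 0;
  scaling_trans : forall x y, x != 0 -> y != 0 -> exists2 a, a != 0 & m a x = y;
  scaling_le : forall a b x, a <= b -> m a x <= m b x }.

Lemma lmul_scaling : scaling (@hmul H).
Proof.
split=> [a|a x a0 x0|x y x0 y0|a b x].
- exact: hmulx0.
- by rewrite gmul_eq0 negb_or a0.
- exists (y * ginv x); first by rewrite gmul_eq0 negb_or y0 ginv_neq0.
  by rewrite -hmulA gmulVx// hmulx1.
- exact: gmul_ler.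
Qed.

Lemma rmul_scaling : scaling (fun a x => x * a).
Proof.
split=> [a|a x a0 x0|x y x0 y0|a b x].
- exact: hmul0x.
- by rewrite gmul_eq0 negb_or a0 x0.
- exists (ginv x * y); first by rewrite gmul_eq0 negb_or y0 ginv_neq0.
  by rewrite hmulA gmulV// hmul1x.
- exact: gmul_le.
Qed.

Definition vscale (m : H -> H -> H) (a : H) X : vec := [ffun e => m a (X e)].

Lemma supp_vscale m a X : scaling m -> a != 0 -> supp (vscale m a X) = supp X.
Proof.
move=> sm a0; apply/setP => e; rewrite !in_supp ffunE.
have [->|x0] := eqVneq (X e) 0; first by rewrite (scaling_x0 sm) eqxx.
exact: scaling_neq0.
Qed.

(** The scalar is the least of those carrying some X g to W g, and j is where this least value
    occurs. *)
Lemma scale_below m X W (A : {set E}) : scaling m -> A != finset.set0 ->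
  (forall g, g \in A -> X g != 0) -> (forall g, g \in A -> W g != 0) ->
  exists a j, [/\ a != 0, j \in A, m a (X j) = W j &
    forall g, g \in A -> m a (X g) <= W g].
Proof.
move=> sm /finset.set0Pn[j0 j0A] XA WA.
have /choice[al alP] : forall g, exists a, g \in A -> a != 0 /\ m a (X g) = W g.
  move=> g; have [gA|gA] := boolP (g \in A); last by exists 1.
  by have [a a0 e] := scaling_trans sm (XA g gA) (WA g gA); exists a.
have [j jA jmin] := arg_minP al j0A.
have [a0 e] := alP j jA; exists (al j), j; split=> // g gA.
by have [_ <-] := alP g gA; apply: scaling_le => //; exact: jmin.
Qed.

(** As E is finite, these are the componentwise maxima of finite families in C, the empty family
    giving the zero vector. *)
Definition spanned (C : set vec) : set vec := [set V | forall f, V f != 0 ->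
  exists X, [/\ C X, forall g, X g <= V g & X f = V f]].

Definition perp (C : set vec) : set vec := [set Y | forall X, C X -> orthogonal X Y].

Variable C : set vec.
Hypothesis CA : circuit_axioms (@lscale H E) C.

Let F := supports C.

Lemma circuit_lscale a X : a != 0 -> C X -> C (lscale a X).
Proof. by move=> /eqP a0; apply: circuit_C1. Qed.

Lemma supp_lscale a X : a != 0 -> supp (lscale a X) = supp X.
Proof. exact: (supp_vscale X lmul_scaling). Qed.

Lemma circuit_normalize X e y : C X -> X e != 0 -> y != 0 ->
  exists Z, [/\ C Z, supp Z = supp X & Z e = y].
Proof.
move=> CX Xe y0; have [a a0 aE] := scaling_trans lmul_scaling Xe y0.
exists (lscale a X); rewrite supp_lscale// ffunE; split=> //.
exact: circuit_lscale.
Qed.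

Lemma supports_antichain P Q : F P -> F Q -> (P \subset Q) -> P = Q.
Proof.
move=> [X CX <-] [Y CY <-] /(circuit_C2 CA CX CY)[a a0 ->].
by rewrite supp_lscale//; apply/eqP.
Qed.

Lemma modular_pair_sets X Y : modular_sets F (supp X) (supp Y) -> modular_pair C X Y.
Proof.
move=> [XY h]; split=> // X' Y' CX' CY'.
by apply: h; [exists X'|exists Y'].
Qed.

Lemma elim_supp X Y Z e : Z e = 0 -> (forall f, (X f [+] Y f) (Z f)) ->
  (supp Z \subset (supp X :|: supp Y) :\ e)%SET.
Proof.
move=> Ze h; apply/fintype.subsetP => f; rewrite !inE => Zf.
apply/andP; split; first by apply: contraNneq Zf => ->; apply/eqP.
apply: contraNT Zf; rewrite negb_or !negbK => /andP[/eqP X0 /eqP Y0].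
by move: (h f); rewrite X0 Y0 haddx0 => /= ->.
Qed.

Lemma supports_modular_elim P Q e : F P -> F Q -> modular_sets F P Q ->
  e \in P -> e \in Q -> exists2 R, F R & (R \subset (P :|: Q) :\ e)%SET.
Proof.
move=> [X CX <-] [Y CY <-] m; rewrite !in_supp => eX eY.
have [W [CW sW eW]] := circuit_normalize CY eY eX.
have mW : modular_pair C X W by apply: modular_pair_sets; rewrite sW.
have [Z [CZ Ze h]] := circuit_C3 CA CX CW mW (esym eW) (elimN eqP eX).
exists (supp Z); first by exists Z.
by rewrite -sW; apply: elim_supp.
Qed.

(** For a modular pair, different values at g would survive the elimination of e and leave a circuit
    meeting D in g alone. A pair that is not modular is split by [modular_bridge] into two pairs
    with smaller unions. *)
Lemma pair_ratio (D : {set E}) X X' e g : no_single_meet F D -> e != g ->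
  C X -> C X' -> (supp X :&: D = [set e; g])%SET ->
  (supp X' :&: D = [set e; g])%SET -> X e = X' e -> X g = X' g.
Proof.
move=> nD eg.
have [n] := ubnP #|(supp X :|: supp X')%SET|; elim: n X X' => // n IH X X' /[!ltnS].
move=> ltn CX CX' XD X'D Xe.
have memD V : (supp V :&: D = [set e; g])%SET ->
    [/\ V e != 0, V g != 0, e \in D & g \in D].
  move=> /setP VD; have := VD e; have := VD g.
  by rewrite !inE !eqxx orbT /= => /andP[-> ->] /andP[-> ->].
have [Xe0 Xg0 eD gD] := memD _ XD.
have [ss|ss] := pselect (supp X = supp X').
  have [|a a0 X'E] := circuit_C2 CA CX CX'; first by rewrite ss.
  move: Xe; rewrite X'E !ffunE -{1}[X e]hmul1x => /(gmulKr Xe0) <-.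
  by rewrite hmul1x.
have [m|m] := pselect (modular_sets F (supp X) (supp X')).
  have [Z [CZ Ze h]] := circuit_C3 CA CX CX' (modular_pair_sets m) Xe (elimN eqP Xe0).
  apply: contrapT => Xg; have Zg := gadd_neq (h g) Xg.
  have gZ : g \in supp Z.
    by rewrite in_supp Zg -gmax_gt0 lt_max gmax_gt0 Xg0.
  have FZ : F (supp Z) by exists Z.
  have [y [yZ yD yg]] := no_single_meetP nD FZ gZ gD.
  have := fintype.subsetP (elim_supp Ze h) y yZ.
  have : y \in (supp X :&: D)%SET = (y \in [set e; g])%SET by rewrite XD.
  have : y \in (supp X' :&: D)%SET = (y \in [set e; g])%SET by rewrite X'D.
  rewrite !inE yD !andbT (negPf yg) orbF => -> ->.
  by rewrite orbb andNb.
have [||_ [[R CR <-] RD lt1 lt2]] := modular_bridge supports_antichain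
  supports_modular_elim nD _ _ ss m eg XD X'D; [by exists X|by exists X'|].
have [Re0 _ _ _] := memD _ RD.
have [Z [CZ sZ Ze]] := circuit_normalize CR Re0 Xe0.
rewrite -sZ in RD lt1 lt2.
rewrite (IH X Z)// ?Ze//; last exact: leq_trans (fintype.proper_card lt1) ltn.
rewrite (IH Z X')// ?Ze//; exact: leq_trans (fintype.proper_card lt2) ltn.
Qed.

(** Induction on the number of elements of [supp X] in D other than e. Leaving e out of the count
    allows the circuit used for elimination to contain e even when X does not. *)
Lemma cocircuit_orthogonal (D : {set E}) Y e :
  no_single_meet F D -> supp Y = D -> e \in D ->
  (forall g h, g \in D -> h \in D -> g != h ->
      exists2 P, F P & (P :&: D = [set g; h])%SET) ->
  (forall X g, C X -> e != g -> (supp X :&: D = [set e; g])%SET ->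
      X e * Y e = X g * Y g) ->
  perp C Y.
Proof.
move=> nD sY eD pairD base X.
have YD g : (Y g != 0) = (g \in D) by rewrite -sY in_supp.
have [n] := ubnP #|((supp X :&: D) :\ e)%SET|; elim: n X => // n IH X /[!ltnS] ltn CX.
apply: contrapT => /orthPn[c]; rewrite gmul_eq0 negb_or YD => /andP[Xc cD] cmax.
have FX : F (supp X) by exists X.
have no_pair g : g != e -> X g != 0 -> g \in D -> X e != 0 -> c \in [set e; g]%SET ->
    ~ (forall y, X y != 0 -> y \in D -> (y == e) || (y == g)).
  move=> ge Xg gD Xe ceg h; have eg : e != g by rewrite eq_sym.
  have XD : (supp X :&: D = [set e; g])%SET.
    apply/setP => y; rewrite !inE; apply/andP/orP => [[y0 yD]|].
      by apply/orP; exact: h.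
    by case=> /eqP->.
  have := base X g CX eg XD; move: ceg; rewrite !inE => /orP[]/eqP ce; rewrite ce in cmax.
    by have := cmax g ge => /[swap] ->; rewrite ltxx.
  by have := cmax e eg => /[swap] ->; rewrite ltxx.
(* Without such an h, X would meet D exactly in {e, c} with c different from e, where [base] makes
   the two terms equal and so excludes a unique maximum. *)
have [h [Xh hD he hc]] : exists h, [/\ X h != 0, h \in D, h != e & h != c].
  apply: contrapT => nh.
  have only y : X y != 0 -> y \in D -> (y == e) || (y == c).
    move=> Xy yD; have [//|ye/=] := eqVneq y e; apply/negP => /negP yc.
    by apply: nh; exists y.
  have cX : c \in supp X by rewrite in_supp.
  have [y [yX yD yc]] := no_single_meetP nD FX cX cD.
  rewrite in_supp in yX; have := only y yX yD; rewrite (negPf yc) orbF => /eqP ye.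
  by apply: (no_pair c) => //; [rewrite -ye eq_sym|rewrite -ye|rewrite !inE eqxx orbT].
(* The circuit comes from a pair in D: {g, h} when c = e, and {e, h} otherwise. *)
have [_ [[W0 CW0 <-] cW0 W0D sW0]] : exists P, [/\ F P, c \notin P,
    (P :&: D != finset.set0)%SET &
    forall y, y \in P -> y \in D -> X y != 0 \/ y = e].
  have [ce|ce] := eqVneq c e.
    have [g [Xg gD ge gh]] : exists g, [/\ X g != 0, g \in D, g != e & g != h].
      apply: contrapT => ng; apply: (no_pair h) => //; first by rewrite -ce.
        by rewrite ce !inE eqxx.
      move=> y Xy yD; have [//|ye/=] := eqVneq y e; apply/negP => /negP yh.
      by apply: ng; exists y.
    have [P FP PD] := pairD g h gD hD gh.
    have mP y : y \in D -> (y \in P) = (y == g) || (y == h).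
      by move=> yD; move/setP/(_ y): PD; rewrite !inE yD andbT.
    exists P; split=> //; first by rewrite mP// negb_or ce eq_sym ge eq_sym he.
      by apply/finset.set0Pn; exists g; rewrite inE mP// gD eqxx.
    by move=> y /[swap] yD; rewrite mP// => /orP[]/eqP->; left.
  have eh : e != h by rewrite eq_sym.
  have [P FP PD] := pairD e h eD hD eh.
  have mP y : y \in D -> (y \in P) = (y == e) || (y == h).
    by move=> yD; move/setP/(_ y): PD; rewrite !inE yD andbT.
  exists P; split=> //; first by rewrite mP// negb_or ce eq_sym hc.
    by apply/finset.set0Pn; exists e; rewrite inE mP// eD eqxx.
  by move=> y /[swap] yD; rewrite mP// => /orP[]/eqP->; [right|left].
have FW0 : F (supp W0) by exists W0.
have cX : c \in supp X by rewrite in_supp.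
have [_ [[W1 CW1 <-] mW1 cW1 W1D sW1]] := modular_avoiding supports_antichain
  supports_modular_elim FX FW0 cX cW0 W0D.
have sub1 y : W1 y != 0 -> y \in D -> X y != 0 \/ y = e.
  move=> Wy yD; have yW : y \in supp W1 by rewrite in_supp.
  have := fintype.subsetP sW1 y yW; rewrite inE in_supp => /orP[|yW0]; first by left.
  exact: sW0.
(* The scaling must ignore e, where X may vanish. The set is still nonempty, since no circuit meets
   D in e alone. *)
pose A := ((supp W1 :&: D) :\ e)%SET.
have A0 : A != finset.set0.
  have /finset.set0Pn[y] := W1D; rewrite inE => /andP[yW yD].
  have [ye|ye] := eqVneq y e; last first.
    by apply/finset.set0Pn; exists y; rewrite !inE ye yD -in_supp yW.
  have FW1 : F (supp W1) by exists W1.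
  have [z [zW zD zy]] := no_single_meetP nD FW1 yW yD.
  by apply/finset.set0Pn; exists z; rewrite !inE -{1}ye zy zD -in_supp zW.
have [||a [j [a0 jA aj ale]]] := scale_below lmul_scaling A0 (X := W1) (W := X).
- by move=> g; rewrite !inE => /and3P[].
- by move=> g; rewrite !inE => /and3P[ge Wg gD]; case: (sub1 g Wg gD) => // /eqP;
    rewrite (negPf ge).
pose W := lscale a W1.
have CW : C W by exact: circuit_lscale.
have sW : supp W = supp W1 by exact: supp_lscale.
have {}aj : W j = X j by rewrite ffunE.
have Wc : W c = 0 by apply/eqP; rewrite -[_ == _]negbK -in_supp sW.
have Wle g : g != e -> g \in D -> W g <= X g.
  move=> ge gD; have [g0|g0] := eqVneq (W g) 0; first by rewrite g0 gmax_ge0.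
  by rewrite ffunE; apply: ale; rewrite !inE ge gD -in_supp -sW in_supp g0.
have mW : modular_pair C X W by apply: modular_pair_sets; rewrite sW.
have [je [jW jD]] : j != e /\ W j != 0 /\ j \in D.
  by move: jA; rewrite !inE => /and3P[-> Wj ->]; rewrite -in_supp sW in_supp.
have Xj : X j != 0 by rewrite -aj.
have m0 : 0 < X c * Y c by rewrite gmax_gt0 gmul_eq0 negb_or Xc YD.
have Wlt g : g != e -> W g * Y g < X c * Y c.
  move=> ge; have [->|gc] := eqVneq g c; first by rewrite Wc hmul0x.
  have [gD|gD] := boolP (g \in D); last first.
    by move: gD; rewrite -YD negbK => /eqP->; rewrite hmulx0.
  by apply: le_lt_trans (cmax g gc); apply: gmul_ler; exact: Wle.
(* At e there is no comparison with X. But W misses c, so if its term at e is nonzero the induction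
   hypothesis applies to W and bounds that term by one already known to be small. *)
have Wlte : W e * Y e < X c * Y c.
  have [We|We] := eqVneq (W e * Y e) 0; first by rewrite We.
  have : orthogonal W Y.
    apply: IH => //; apply: leq_trans ltn; apply: fintype.proper_card.
    have ce : c != e by apply: contraNneq We => <-; rewrite Wc hmul0x.
    apply: (proper_of_mem (x := c)).
    - apply/fintype.subsetP => y; rewrite !inE => /and3P[ye Wy yD].
      rewrite ye yD /= andbT; move: Wy; rewrite -in_supp sW in_supp => Wy.
      by case: (sub1 y Wy yD) => // /eqP; rewrite (negPf ye).
    - by rewrite !inE ce Xc.
    - by rewrite !inE Wc eqxx andbF.
  move/orthP => /(_ e We)[g ge le]; exact: le_lt_trans (Wlt g ge).
(* Z loses j but keeps the value of X at c, while all its other terms stay strictly below the one at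
   c. This contradicts the induction hypothesis for Z. *)
have [Z [CZ Zj h']] := circuit_C3 CA CX CW mW (esym aj) (elimN eqP Xj).
have Zc : Z c = X c by apply: (gadd_lt (h' c)); rewrite Wc gmax_gt0.
have : orthogonal Z Y.
  apply: IH => //; apply: leq_trans ltn; apply: fintype.proper_card.
  apply: (proper_of_mem (x := j)).
  - apply/fintype.subsetP => y; rewrite !inE => /and3P[ye Zy yD].
    rewrite ye yD /= andbT; apply: contraNneq Zy => Xy.
    have := Wle y ye yD; rewrite Xy gmax_le0 => /eqP Wy.
    by have := h' y; rewrite Xy Wy haddx0 => /= ->.
  - by rewrite !inE je Xj.
  - by rewrite !inE Zj eqxx andbF.
move/orthP => /(_ c); rewrite Zc -gmax_gt0 => /(_ m0)[g gc].
apply/negP; rewrite -ltNge.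
apply: (@le_lt_trans _ _ (Order.max (X g) (W g) * Y g)).
  by apply: gmul_ler; apply: gadd_le.
case: (leP (X g) (W g)) => _; last exact: cmax.
by have [->|ge] := eqVneq g e; [|apply: Wlt].
Qed.

Lemma spanned_circuit X : C X -> spanned C X.
Proof. by move=> CX f _; exists X. Qed.

Lemma spanned_perp V Y : spanned C V -> perp C Y -> orthogonal V Y.
Proof.
move=> SV TY; apply/orthP => e; rewrite gmul_eq0 negb_or => /andP[Ve Ye].
have [X [CX leX Xe]] := SV e Ve.
move/orthP: (TY X CX) => /(_ e); rewrite Xe gmul_eq0 negb_or Ve Ye.
move=> /(_ isT)[g ge le]; exists g => //; apply: le_trans le _.
exact: gmul_ler.
Qed.

Lemma painting f (A : {set E}) : f \notin A ->
  (exists V, [/\ spanned C V, V f = 1 & forall g, g != f -> g \notin A -> V g = 0]) \/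
  (exists Y, [/\ perp C Y, Y f = 1 & forall g, g \in A -> Y g = 0]).
Proof.
move=> fA.
have [[P [[X CX <-] fX sX]]|nX] :=
    pselect (exists P, [/\ F P, f \in P & P \subset (f |: A)%SET]).
  rewrite in_supp in fX; left.
  have [V [CV sV Vf]] := circuit_normalize CX fX (isT : 1 != 0).
  exists V; split=> //; first exact: spanned_circuit.
  move=> g gf gA; apply/eqP; rewrite -[_ == _]negbK -in_supp sV.
  apply/negP => /(fintype.subsetP sX); rewrite !inE (negPf gf) (negPf gA).
  by [].
right; have [|D [fD AD nD pairD]] := cocircuit_exists supports_antichain
  supports_modular_elim fA.
  by move=> P FP fP sP; apply: nX; exists P.
(* One circuit is chosen for each pair {f, g} in D; the zero vector fills the remaining indices. *)
have /choice[XX XXP] : forall g, exists X, g \in D -> g != f ->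
    C X /\ (supp X :&: D = [set f; g])%SET.
  move=> g; have [gD|gD] := boolP (g \in D); last by exists (vzero H E).
  have [gf|gf] := eqVneq g f; first by exists (vzero H E).
  have [|_ [X CX <-] XD] := pairD f g fD gD; first by rewrite eq_sym.
  by exists X.
have nz X g : (supp X :&: D = [set f; g])%SET -> X f != 0 /\ X g != 0.
  move=> XD; move/setP/(_ f): (XD); move/setP/(_ g): XD.
  by rewrite !inE !eqxx orbT /= => /andP[-> _] /andP[-> _].
(* The value at g solves X_f = X_g * Y_g for the chosen circuit X, as orthogonality with Y_f = 1
   demands. *)
pose Y : vec := [ffun g => if g == f then 1 else
  if g \in D then ginv (XX g g) * XX g f else 0].
have Yf : Y f = 1 by rewrite ffunE eqxx.
exists Y; split=> //; last first.
  move=> g gA; have gD : g \notin D.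
    by apply/negP => /(fintype.subsetP AD); rewrite inE gA.
  by rewrite ffunE (negPf gD); case: eqP => // gf; rewrite gf fD in gD.
apply: (@cocircuit_orthogonal D Y f) => //.
  apply/setP => g; rewrite in_supp ffunE; have [->//|gf] := eqVneq g f.
  case: ifP => // gD; have [_ /nz[xf xg]] := XXP g gD gf.
  by rewrite gmul_eq0 negb_or ginv_neq0.
move=> X g CX fg XD; have [Xf Xg] := nz _ _ XD.
have gf : g != f by rewrite eq_sym.
have gD : g \in D by move/setP/(_ g): XD; rewrite !inE eqxx orbT => /andP[].
have [CXg XgD] := XXP g gD gf; have [Xgf Xgg] := nz _ _ XgD.
(* Once rescaled to agree at f, X agrees with the chosen circuit at g by [pair_ratio], so the
   equation defining Y_g holds for X too. *)
have [a a0 aE] := scaling_trans lmul_scaling Xf Xgf.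
have e : lscale a X g = XX g g.
  apply: (pair_ratio nD fg) => //; first exact: circuit_lscale.
    by rewrite supp_lscale.
  by rewrite ffunE.
apply: (gmulKl a0); rewrite Yf hmulx1 aE hmulA.
move: e; rewrite ffunE => ->.
by rewrite ffunE (negPf gf) gD hmulA gmulV// hmul1x.
Qed.

End ValuatedCircuits.

(** * Sets satisfying (V0)-(V3) and their minimal supports *)

Section VectorSystems.
Variables (d : Order.disp_t) (G : orderedGroupType d) (E : finType).
Local Notation H := (Gmax G).
Local Notation vec := {ffun E -> H}.
Local Notation "0" := (hzero : H) : hyper_scope.
Local Notation "1" := (hone : H) : hyper_scope.
Local Notation v0 := (vzero H E).
Implicit Types (X Y V W Z : vec) (Q S T : set vec) (m : H -> H -> H).

(** The side of the multiplication is a parameter, so that the vectors of a left matroid and their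
    orthogonal complement are treated together. *)
Record vector_system m Q : Prop := VectorSystem {
  vs_zero : Q v0;
  vs_scale : forall a V, a != 0 -> Q V -> Q (vscale m a V);
  vs_comp : forall V W, Q V -> Q W -> Q (vcomp V W);
  vs_elim : forall V W e, Q V -> Q W -> V e = W e -> V e != 0 ->
    exists Z, [/\ Q Z, forall f, (V f [+] W f) (Z f) & Z e = 0] }.

Lemma supp_eq0 V : supp V = finset.set0 -> V = v0.
Proof.
move=> /setP s0; apply/ffunP => e; rewrite ffunE; apply/eqP.
by have := s0 e; rewrite in_supp inE => /negbFE.
Qed.

Lemma neq_vzero V : V <> v0 <-> exists e, V e != 0.
Proof.
split=> [h|[e] /[swap] ->]; last by rewrite ffunE eqxx.
apply: contrapT => n; apply: h; apply/ffunP => e; rewrite ffunE; apply/eqP.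
by apply/negP => /negP Ve; apply: n; exists e.
Qed.

Lemma join_attaining Q V (s : seq E) : Q v0 ->
  (forall V W, Q V -> Q W -> Q (vcomp V W)) ->
  (forall f, f \in s -> exists Z, [/\ Q Z, forall g, Z g <= V g & Z f = V f]) ->
  exists Z, [/\ Q Z, forall g, Z g <= V g & forall f, f \in s -> Z f = V f].
Proof.
move=> Q0 Qc; elim: s => [_|f s IH h].
  by exists v0; split=> // g; rewrite ffunE gmax_ge0.
have [|Z [QZ leZ Zs]] := IH.
  by move=> g gs; apply: h; rewrite inE gs orbT.
have [|Z' [QZ' leZ' Zf]] := h f; first by rewrite mem_head.
exists (vcomp Z Z'); split=> [|g|g]; first exact: Qc.
  by rewrite ffunE ge_max leZ leZ'.
rewrite inE ffunE => /orP[/eqP->|/Zs ->].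
  by rewrite Zf max_r.
by rewrite max_l.
Qed.

Lemma spanned_sub Q : Q v0 -> (forall V W, Q V -> Q W -> Q (vcomp V W)) ->
  spanned Q `<=` Q.
Proof.
move=> Q0 Qc V SV.
have [|Z [QZ _ Zs]] := @join_attaining Q V (enum E) Q0 Qc.
  move=> f _; have [Vf|/SV//] := eqVneq (V f) 0.
  by exists v0; split=> // [g|]; rewrite ffunE ?Vf// gmax_ge0.
suff -> : V = Z by [].
by apply/ffunP => e; rewrite Zs ?mem_enum.
Qed.

(** The hypersum prescribes a value only where V and W differ; elsewhere it is just an upper bound.
    Joining one solution for each such coordinate attains all the prescribed values and still
    vanishes at e. *)
Lemma elim_of_pointwise Q : Q v0 -> (forall V W, Q V -> Q W -> Q (vcomp V W)) ->
  (forall V W e f, Q V -> Q W -> V e = W e -> V e != 0 -> W f < V f ->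
    exists Z, [/\ Q Z, Z e = 0, forall g, Z g <= vcomp V W g & Z f = V f]) ->
  forall V W e, Q V -> Q W -> V e = W e -> V e != 0 ->
    exists Z, [/\ Q Z, forall f, (V f [+] W f) (Z f) & Z e = 0].
Proof.
move=> Q0 Qc pw V W e QV QW VWe Ve.
pose Qe := [set Z | Q Z /\ Z e = 0].
have [|||Z [[QZ Ze] leZ Zs]] :=
    @join_attaining Qe (vcomp V W) [seq f <- enum E | V f != W f].
- by split=> //; rewrite ffunE.
- move=> Y Y' [QY Ye] [QY' Y'e]; split; first exact: Qc.
  by rewrite ffunE Ye Y'e max_l.
- move=> f; rewrite mem_filter neq_lt => /andP[/orP[lt|lt] _].
    have [||Z [QZ Ze leZ Zf]] := pw W V e f QW QV _ _ lt; rewrite -?VWe//.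
    exists Z; split=> // [g|]; first by have := leZ g; rewrite !ffunE maxC.
    by rewrite Zf ffunE (max_r (ltW lt)).
  have [Z [QZ Ze leZ Zf]] := pw V W e f QV QW VWe Ve lt.
  by exists Z; split=> //; rewrite Zf ffunE (max_l (ltW lt)).
exists Z; split=> // f; rewrite /hadd /= /gmax_add.
have [VWf|VWf] := eqVneq (V f) (W f).
  by have := leZ f; rewrite ffunE -VWf maxxx.
by rewrite /= Zs ?ffunE// mem_filter VWf mem_enum.
Qed.

Lemma vcomp_le V W g : V g <= vcomp V W g /\ W g <= vcomp V W g.
Proof. by rewrite ffunE !le_max !lexx orbT. Qed.

Lemma minsupp_exists Q V : Q V -> V <> v0 ->
  exists2 X, minsupp (Q `\` [set v0]) X & supp X \subset supp V.
Proof.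
have [n] := ubnP #|supp V|; elim: n V => // n IH V /[!ltnS] ltn QV V0.
have [mV|mV] := pselect (minsupp (Q `\` [set v0]) V); first by exists V.
have [W [[QW W0] lt]] : exists W, (Q `\` [set v0]) W /\ supp W \proper supp V.
  apply: contrapT => h; apply: mV; split=> // Y QY lt.
  by apply: h; exists Y.
have [|X mX sX] := IH W _ QW W0.
  exact: leq_trans (fintype.proper_card lt) ltn.
by exists X => //; exact: fintype.subset_trans sX (fintype.proper_sub lt).
Qed.

Lemma minsupp_same_supp Q X V : minsupp (Q `\` [set v0]) X -> Q V -> V <> v0 ->
  supp V \subset supp X -> supp V = supp X.
Proof.
move=> [_ h] QV V0 sV; have /negP := h V (conj QV V0).
by rewrite fintype.properE sV /= negbK => sX; apply/eqP; rewrite finset.eqEsubset sV.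
Qed.

Variables (m : H -> H -> H) (Q : set vec).
Hypotheses (sm : scaling m) (vs : vector_system m Q).
Local Notation MQ := (minsupp (Q `\` [set v0])).

Lemma minsupp_scale a X : a != 0 -> MQ X -> MQ (vscale m a X).
Proof.
move=> a0 [[QX X0] h]; have sX := supp_vscale X sm a0; split; last first.
  by rewrite sX.
split; first exact: vs_scale.
move/neq_vzero: X0 => [e]; rewrite -in_supp -sX in_supp => Xe.
by apply/neq_vzero; exists e.
Qed.

(** Scale X to agree with Y at e and eliminate e. The result has support strictly inside that of Y,
    hence is zero, and 0 lies in a hypersum only of equal elements. *)
Lemma minsupp_proportional X Y : MQ X -> MQ Y -> supp X \subset supp Y ->
  exists2 a, a <> 0 & Y = vscale m a X.
Proof.
move=> mX mY sXY; have [[QX X0] _] := mX; have [[QY Y0] _] := mY.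
have ss := minsupp_same_supp mY QX X0 sXY.
have /neq_vzero[e Xe] := X0.
have Ye : Y e != 0 by rewrite -in_supp -ss in_supp.
have [a a0 ae] := scaling_trans sm Xe Ye.
exists a; first exact/eqP.
have [[QX' X'0] _] := minsupp_scale a0 mX.
have X'e : vscale m a X e = Y e by rewrite ffunE.
have [|Z [QZ h Ze]] := vs_elim vs QX' QY X'e; first by rewrite X'e.
have sZ : supp Z \subset supp Y.
  apply: fintype.subset_trans (elim_supp Ze h) _.
  rewrite supp_vscale// ss finset.setUid; exact: finset.subsetDl.
have Z0 : Z = v0.
  apply: contrapT => Z0; have eZ := minsupp_same_supp mY QZ Z0 sZ.
  by move: Ye; rewrite -in_supp -eZ in_supp Ze eqxx.
apply/ffunP => f; have := h f; rewrite Z0 [v0 f]ffunE => /gmax_addN //.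
Qed.

(** For modular elimination, let Z come from [vs_elim]. If Z were not minimal, eliminating a minimal
    Z1 from it would leave a nonzero vector above a second minimal Z3. Both supports would lie in
    the union of those of X and Y without e, against modularity. *)
Lemma minsupp_circuit_axioms : circuit_axioms (vscale m) MQ.
Proof.
split.
- by case=> -[_ n] _; apply: n.
- by move=> a X /eqP; apply: minsupp_scale.
- exact: minsupp_proportional.
move=> X Y e mX mY [sXY mod] XYe /eqP Xe.
have [[QX X0] _] := mX; have [[QY Y0] _] := mY.
have [Z [QZ h Ze]] := vs_elim vs QX QY XYe Xe.
exists Z; split=> //.
have sZ := elim_supp Ze h.
have Z0 : Z <> v0.
  move=> Z0; apply: sXY; suff -> : X = Y by [].
  by apply/ffunP => f; have := h f; rewrite Z0 [v0 f]ffunE => /gmax_addN.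
have [Z1 mZ1 sZ1] := minsupp_exists QZ Z0.
apply: contrapT => nZ.
have [[QZ1 Z10] _] := mZ1; have /neq_vzero[e1 Z1e1] := Z10.
have Ze1 : Z e1 != 0 by rewrite -in_supp (fintype.subsetP sZ1)// in_supp.
have [g Zg Z1g] : exists2 g, g \in supp Z & g \notin supp Z1.
  apply/fintype.subsetPn/negP => sZ1'; apply: nZ.
  split=> // V [QV V0] lt; apply: (mZ1.2 V) => //.
  by apply: fintype.proper_sub_trans lt sZ1'.
have [a a0 ae] := scaling_trans sm Z1e1 Ze1.
have [[QZ1' _] _] := minsupp_scale a0 mZ1.
have Z1'e : Z e1 = vscale m a Z1 e1 by rewrite ffunE.
have [Z2 [QZ2 h2 Z2e]] := vs_elim vs QZ QZ1' Z1'e Ze1.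
have sZ2 := elim_supp Z2e h2.
have Z20 : Z2 <> v0.
  apply/neq_vzero; exists g; rewrite in_supp in Zg.
  move: Z1g; rewrite in_supp negbK => /eqP Z1g.
  rewrite (gadd_lt (h2 g)) ?ffunE// Z1g (scaling_x0 sm) gmax_gt0 //.
have [Z3 mZ3 sZ3] := minsupp_exists QZ2 Z20.
have Z3e1 : e1 \notin supp Z3.
  apply/negP => /(fintype.subsetP sZ3); by rewrite in_supp Z2e eqxx.
apply: (mod Z1 Z3) => //.
  by move=> s13; rewrite -s13 in_supp Z1e1 in Z3e1.
have sub : (supp Z1 :|: supp Z3 \subset (supp X :|: supp Y) :\ e)%SET.
  rewrite finset.subUset (fintype.subset_trans sZ1 sZ)/=.
  apply: fintype.subset_trans sZ3 _; apply: fintype.subset_trans sZ2 _.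
  rewrite supp_vscale//; apply: fintype.subset_trans (finset.subsetDl _ _) _.
  by rewrite finset.subUset sZ (fintype.subset_trans sZ1 sZ).
apply: fintype.sub_proper_trans sub _; apply: finset.properD1.
by rewrite inE in_supp Xe.
Qed.

(** Descent on a vector W below V that attains V at f: scale a minimal X below W, touching it at j.
    Either X attains f, or eliminating j leaves the value at f intact and shrinks the support. *)
Lemma spanned_minsupp : Q = spanned MQ.
Proof.
apply/seteqP; split; last first.
  apply: (@subset_trans _ (spanned Q)); last first.
    exact: spanned_sub (vs_zero vs) (vs_comp vs).
  by move=> V SV f /SV[X [[[QX _] _] leX Xf]]; exists X.
move=> V QV f Vf.
suff : forall n W, (#|supp W| < n)%N -> Q W -> W f = V f -> (forall g, W g <= V g) ->
    exists X, [/\ MQ X, forall g, X g <= V g & X f = V f].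
  by move=> h; exact: (h #|supp V|.+1 V).
elim=> // n IH W /[!ltnS] ltn QW Wf leW.
have W0 : W <> v0 by apply/neq_vzero; exists f; rewrite Wf.
have [X mX sX] := minsupp_exists QW W0.
have [[QX X0] _] := mX.
have XX : supp X != finset.set0 by apply/eqP => /supp_eq0.
have [||a [j [a0 jX aj ale]]] := scale_below sm XX (X := X) (W := W).
- by move=> g; rewrite in_supp.
- by move=> g /(fintype.subsetP sX); rewrite in_supp.
have mX' := minsupp_scale a0 mX; have [[QX' _] _] := mX'.
have leX' g : vscale m a X g <= W g.
  rewrite ffunE; have [->|Xg] := eqVneq (X g) 0.
    by rewrite (scaling_x0 sm) gmax_ge0.
  by apply: ale; rewrite in_supp.
have [X'f|X'f] := eqVneq (vscale m a X f) (W f).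
  by exists (vscale m a X); rewrite X'f; split=> // g; exact: le_trans (leW g).
have lt : vscale m a X f < W f by rewrite lt_neqAle X'f leX'.
have Wj : W j = vscale m a X j by rewrite ffunE.
have Wj0 : W j != 0 by rewrite -in_supp (fintype.subsetP sX).
have [Z [QZ h Zj]] := vs_elim vs QW QX' Wj Wj0.
have leZ g : Z g <= W g by rewrite (le_trans (gadd_le (h g)))// ge_max lexx leX'.
apply: (IH Z) => //.
- apply: leq_trans ltn; apply: fintype.proper_card; apply: (proper_of_mem (x := j)).
  + apply/fintype.subsetP => g; rewrite !in_supp => Zg.
    by rewrite -gmax_gt0 (lt_le_trans _ (leZ g))// gmax_gt0.
  + by rewrite in_supp.
  + by rewrite in_supp Zj eqxx.
- by rewrite (gadd_lt (h f)).
- by move=> g; exact: le_trans (leW g).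
Qed.

End VectorSystems.

(** * Farkas alternative, bases and duality *)

Section Duality.
Variables (d : Order.disp_t) (G : orderedGroupType d) (E : finType).
Local Notation H := (Gmax G).
Local Notation vec := {ffun E -> H}.
Local Notation "0" := (hzero : H) : hyper_scope.
Local Notation "1" := (hone : H) : hyper_scope.
Local Notation v0 := (vzero H E).
Implicit Types (X Y V W Z : vec) (S T : set vec) (A B P : {set E}).

(* Induction on the coordinates g with I_g not 0 or everything: if neither
   extreme choice of I_g yields a solution respecting the given I_g, the V and Y
   obtained have V_g Y_g as the unique maximum of their products. *)
Lemma farkas S T f (I : E -> set H) :
  (forall V Y, S V -> T Y -> orthogonal V Y) ->
  (forall A, f \notin A ->
    (exists V, [/\ S V, V f = 1 & forall g, g != f -> g \notin A -> V g = 0]) \/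
    (exists Y, [/\ T Y, Y f = 1 & forall g, g \in A -> Y g = 0])) ->
  (forall g, I g 0) -> (forall g x y, x <= y -> I g y -> I g x) ->
  (exists V, [/\ S V, V f = 1 & forall g, g != f -> I g (V g)]) \/
  (exists Y, [/\ T Y, Y f = 1 & forall g, g != f -> forall x, I g x -> x * Y g < 1]).
Proof.
move=> ST paint.
suff main (s : seq E) : forall I : E -> set H,
    (forall g, I g 0) -> (forall g x y, x <= y -> I g y -> I g x) ->
    (forall g, g != f -> g \notin s -> I g = [set 0] \/ I g = setT) ->
    (exists V, [/\ S V, V f = 1 & forall g, g != f -> I g (V g)]) \/
    (exists Y, [/\ T Y, Y f = 1 & forall g, g != f -> forall x, I g x -> x * Y g < 1]).
  by move=> I0 Id; apply: (main (enum E)) => // g _; rewrite mem_enum.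
elim: s => [|g s IH] {}I I0 Id triv.
  pose A := [set g | (g != f) && `[< I g = setT >]]%SET.
  have fA : f \notin A by rewrite inE eqxx.
  case: (paint A fA) => [[V [SV Vf VA]]|[Y [TY Yf YA]]]; [left|right].
    exists V; split=> // g gf; case: (triv g gf isT) => [|->//].
    have [gA|gA] := boolP (g \in A).
      by move: gA; rewrite inE => /andP[_ /asboolP->].
    by rewrite (VA g gf gA).
  exists Y; split=> // g gf x; case: (triv g gf isT) => [->->|It].
    by rewrite hmul0x gmax_gt0.
  by rewrite YA ?hmulx0 ?gmax_gt0// inE gf; apply/asboolP.
have [gf|gf] := eqVneq g f.
  by apply: IH => // h hf hs; apply: triv; rewrite // inE gf (negPf hf).
pose J K h : set H := if h == g then K else I h.
have sub K : (K = [set 0] \/ K = setT) ->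
    (exists V, [/\ S V, V f = 1 & forall h, h != f -> J K h (V h)]) \/
    (exists Y, [/\ T Y, Y f = 1 & forall h, h != f -> forall x, J K h x -> x * Y h < 1]).
  move=> HK; apply: IH => [h|h x y|h hf hs]; rewrite /J; case: ifP => // hg.
  - by case: HK => ->.
  - by case: HK => -> // /[swap] -> /=; rewrite gmax_le0 => /eqP.
  - exact: Id.
  - by apply: triv; rewrite // inE hg.
have [[V [SV Vf VJ]]|[Y [TY Yf YJ]]] := sub [set 0] (or_introl erefl).
  left; exists V; split=> // h /VJ; rewrite /J; case: eqP => // -> ->.
  exact: I0.
have [[V [SV Vf VJ]]|[Y' [TY' Y'f Y'J]]] := sub setT (or_intror erefl); last first.
  right; exists Y'; split=> // h hf x Ix; apply: Y'J => //; rewrite /J.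
  by case: eqP.
have [IV|IV] := pselect (I g (V g)).
  left; exists V; split=> // h hf; have := VJ h hf; rewrite /J.
  by case: eqP => // ->.
have [IY|IY] := pselect (forall x, I g x -> x * Y g < 1).
  right; exists Y; split=> // h hf x; have := YJ h hf x; rewrite /J.
  by case: eqP => // -> _; exact: IY.
have [x [Ix xY]] : exists x, I g x /\ 1 <= x * Y g.
  apply: contrapT => n; apply: IY => x Ix; rewrite ltNge; apply/negP => le.
  by apply: n; exists x.
have xV : x < V g.
  by rewrite ltNge; apply/negP => le; apply: IV; exact: Id le Ix.
have Yg : Y g != 0 by apply: contraTneq xY => ->; rewrite hmulx0 -ltNge gmax_gt0.
have VY : 1 < V g * Y g by apply: le_lt_trans xY _; exact: gmul_ltr.
have /orthP/(_ g) := ST _ _ SV TY.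
rewrite -gmax_gt0 (lt_trans _ VY) ?gmax_gt0// => /(_ isT)[h hg].
suff le1 : V h * Y h <= 1 by move=> /(lt_le_trans VY)/lt_le_trans/(_ le1); rewrite ltxx.
have [->|hf] := eqVneq h f; first by rewrite Vf Yf hmulx1.
apply/ltW/(YJ h hf); have := VJ h hf; rewrite /J (negPf hg).
by [].
Qed.

(** * Bases in terms of all vectors instead of circuits *)

Section MinimalSupports.
Variables (C Q : set vec).
Hypotheses (CQ : C `<=` Q `\` [set v0])
  (QC : forall V, Q V -> V <> v0 -> exists2 X, C X & supp X \subset supp V).

Lemma indepE B : indep (supports C) B <-> forall V, Q V -> supp V \subset B -> V = v0.
Proof.
split=> [iB V QV sV|h _ [X CX <-] sX].
  apply: contrapT => V0; have [X CX sX] := QC QV V0.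
  by apply: (iB (supp X)); [exists X|exact: fintype.subset_trans sV].
by have [QX X0] := CQ CX; apply: X0; exact: h.
Qed.

Lemma basisE B : basis (supports C) B <->
  (forall V, Q V -> supp V \subset B -> V = v0) /\
  (forall g, g \notin B -> exists V, [/\ Q V, V g != 0 & supp V \subset (g |: B)%SET]).
Proof.
rewrite /basis indepE; split=> [[iB mB]|[iB sB]]; split=> //.
  move=> g gB; apply: contrapT => n.
  have : g \in B; last by rewrite (negPf gB).
  rewrite -(mB (g |: B)%SET) ?finset.subsetUr// ?inE ?eqxx//.
  apply/indepE => V QV sV; apply: iB => //.
  apply/fintype.subsetP => h hV; have := fintype.subsetP sV h hV.
  rewrite !inE => /orP[/eqP hg|//]; case: n; exists V; split=> //.
  by rewrite -hg -in_supp.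
move=> I /indepE iI BI; apply/eqP; rewrite finset.eqEsubset BI andbT.
apply/fintype.subsetP => g gI; apply/negP => /negP /sB[V [QV Vg sV]].
have V0 : V = v0.
  apply: iI => //; apply: fintype.subset_trans sV _.
  by rewrite finset.subUset finset.sub1set gI.
by move: Vg; rewrite V0 ffunE eqxx.
Qed.

End MinimalSupports.

(** Forwards, paint with A = B minus b: the first alternative would be a nonzero vector inside B.
    Backwards, V inside B and Y inside b plus the complement of B could meet only at b, which [meet]
    forbids. S and T are abstract so that they can be exchanged. *)
Lemma free_dual_spanning S T B :
  (forall V Y b, S V -> T Y -> V b != 0 -> Y b != 0 ->
     exists g, [/\ g != b, V g != 0 & Y g != 0]) ->
  (forall f A, f \notin A ->
    (exists V, [/\ S V, V f != 0 & supp V \subset (f |: A)%SET]) \/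
    (exists Y, [/\ T Y, Y f != 0 & supp Y \subset (~: A)%SET])) ->
  (forall V, S V -> supp V \subset B -> V = v0) <->
  (forall b, b \notin (~: B)%SET ->
     exists Y, [/\ T Y, Y b != 0 & supp Y \subset (b |: ~: B)%SET]).
Proof.
move=> meet paint; split=> [iB b|h V SV sV].
  rewrite inE negbK => bB.
  have bA : b \notin (B :\ b)%SET by rewrite !inE eqxx.
  case: (paint b _ bA) => [[V [SV Vb sV]]|[Y [TY Yb sY]]].
    have V0 : V = v0 by apply: iB => //; rewrite finset.setD1K in sV.
    by move: Vb; rewrite V0 ffunE eqxx.
  exists Y; split=> //; apply: fintype.subset_trans sY _.
  by apply/fintype.subsetP => y; rewrite !inE negb_and negbK.
apply: contrapT => /neq_vzero[b Vb].
have bB : b \notin (~: B)%SET by rewrite inE negbK (fintype.subsetP sV)// in_supp.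
have [Y [TY Yb sY]] := h b bB.
have [g [gb Vg Yg]] := meet V Y b SV TY Vb Yb.
have gB : g \in B by rewrite (fintype.subsetP sV)// in_supp.
have := fintype.subsetP sY g; rewrite in_supp !inE (negPf gb) gB => /(_ Yg).
by [].
Qed.

Lemma indep_basis (F : set {set E}) A : indep F A <->
  exists2 B, basis F B & A \subset B.
Proof.
split=> [iA|[B [iB _] AB] P FP PA]; last first.
  by apply: (iB P) => //; exact: fintype.subset_trans AB.
have [|B /maxsetP[/asboolP iB mB] AB] :=
    @maxset_exists _ (fun B : {set E} => `[< indep F B >]) A; first exact/asboolP.
by exists B => //; split=> // I iI BI; apply: mB => //; exact/asboolP.
Qed.

(** Bases determine the dependent sets. Hence P contains some P' in F', which contains a member of
    F, and the antichain property makes all three equal. *)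
Lemma same_bases_supports (F F' : set {set E}) P :
  (forall B, basis F B <-> basis F' B) ->
  (forall A B, F A -> F B -> A \subset B -> A = B) -> F P -> F' P.
Proof.
move=> FF' anti FP.
have ind A : indep F A <-> indep F' A.
  by rewrite !indep_basis; split=> -[B bB AB]; exists B => //; apply/FF'.
have dep (K : set {set E}) A : ~ indep K A -> exists2 P, K P & P \subset A.
  move=> n; apply: contrapT => h; apply: n => R KR RA; apply: h; by exists R.
have [|P' FP' sP'] := dep F' P; first by move=> /ind /(_ P FP).
have [|P2 FP2 sP2] := dep F P'; first by move=> /ind /(_ P' FP').
have e : P2 = P by apply: anti => //; exact: fintype.subset_trans sP'.
suff -> : P = P' by [].
by apply/eqP; rewrite finset.eqEsubset sP' -{1}e sP2.
Qed.

Lemma orth_two X Y e g : orthogonal X Y ->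
  (forall h, X h != 0 -> Y h != 0 -> (h == e) || (h == g)) -> X e * Y e = X g * Y g.
Proof.
suff half e' g' : orthogonal X Y ->
    (forall h, X h != 0 -> Y h != 0 -> (h == e') || (h == g')) ->
    X e' * Y e' <= X g' * Y g'.
  move=> o h; apply: le_anti; rewrite !half// => y Xy Yy.
  by rewrite orbC; exact: h.
move=> /orthP o h; have [->|p0] := eqVneq (X e' * Y e') 0; first exact: gmax_ge0.
have [k ke le] := o e' p0.
have : X k * Y k != 0 by rewrite -gmax_gt0 (lt_le_trans _ le)// gmax_gt0.
rewrite gmul_eq0 negb_or => /andP[Xk Yk].
by have := h k Xk Yk; rewrite (negPf ke) => /eqP <-.
Qed.

(** * The dual matroid and the vectors of a matroid *)

Section Dual.
Variable M : lmatroid H E.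
Let C := circuits M.
Let CA : circuit_axioms (@lscale H E) C := circuitsP M.
Let S := spanned C.
Let T := perp C.

Lemma farkas_matroid f (I : E -> set H) :
  (forall g, I g 0) -> (forall g x y, x <= y -> I g y -> I g x) ->
  (exists V, [/\ S V, V f = 1 & forall g, g != f -> I g (V g)]) \/
  (exists Y, [/\ T Y, Y f = 1 & forall g, g != f -> forall x, I g x -> x * Y g < 1]).
Proof. by apply: farkas => [V Y|A]; [exact: spanned_perp|exact: painting]. Qed.

Lemma spanned_lscale a V : a != 0 -> S V -> S (lscale a V).
Proof.
move=> a0 SV f; rewrite ffunE gmul_eq0 negb_or => /andP[_ /SV[X [CX leX Xf]]].
exists (lscale a X); split=> [|g|]; first exact: circuit_lscale.
  by rewrite !ffunE; exact: gmul_le.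
by rewrite ffunE Xf.
Qed.

Lemma spanned_comp V W : S V -> S W -> S (vcomp V W).
Proof.
move=> SV SW f; rewrite ffunE; case: (leP (V f) (W f)) => _.
  move=> /SW[X [CX leX Xf]]; exists X; split=> // g.
  exact: le_trans (leX g) (vcomp_le V W g).2.
move=> /SV[X [CX leX Xf]]; exists X; split=> // g.
exact: le_trans (leX g) (vcomp_le V W g).1.
Qed.

Lemma spanned_zero : S v0.
Proof. by move=> f; rewrite ffunE eqxx. Qed.

Lemma spanned_vector_system : vector_system (@hmul H) S.
Proof.
split; [exact: spanned_zero|exact: spanned_lscale|exact: spanned_comp|].
apply: elim_of_pointwise; [exact: spanned_zero|exact: spanned_comp|].
move=> V W e f SV SW VWe Ve lt.
have Vf : V f != 0 by rewrite -gmax_gt0 (le_lt_trans _ lt)// gmax_ge0.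
have ef : e != f by apply: contraTneq lt => <-; rewrite VWe ltxx.
(* The alternative yields vectors with value 1 at f, so the bounds are divided by V f and the
   solution is scaled back. *)
pose u g := ginv (V f) * vcomp V W g.
have uE g : V f * u g = vcomp V W g by rewrite /u hmulA gmulV// hmul1x.
pose I g : set H := if g == e then [set 0] else [set x | x <= u g].
have [||[Z [SZ Zf ZI]]|[Y [TY Yf YI]]] := @farkas_matroid f I.
- by move=> g; rewrite /I; case: ifP => // _; exact: gmax_ge0.
- move=> g x y xy; rewrite /I; case: ifP => _ /=; last exact: le_trans.
  by move=> y0; apply/eqP; rewrite -gmax_le0 -y0.
- exists (lscale (V f) Z); split=> [||g|]; first exact: spanned_lscale.
  + by have := ZI e ef; rewrite ffunE /I eqxx => ->; rewrite hmulx0.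
  + have [->|gf] := eqVneq g f; first by rewrite ffunE Zf hmulx1 (vcomp_le V W f).1.
    have := ZI g gf; rewrite [lscale _ _ _]ffunE /I; case: eqP => [_ ->|_ le].
      by rewrite hmulx0 gmax_ge0.
    by rewrite -uE; exact: gmul_le.
  + by rewrite ffunE Zf hmulx1.
have small g : g != e -> g != f -> vcomp V W g * Y g < V f.
  move=> ge gf; have := YI g gf (u g); rewrite /I (negPf ge) /= => /(_ (lexx _)).
  by move=> /(gmul_lt Vf); rewrite hmulA uE hmulx1.
(* Y is refuted in two rounds: orthogonality to V makes the term at e at least V f, and then
   orthogonality to W, which agrees with V at e, needs another term that large. At f this fails
   because W f < V f, elsewhere by [small]. *)
have /orthP/(_ f) := spanned_perp SV TY; rewrite Yf hmulx1 => /(_ Vf)[g gf].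
have [->|ge] := eqVneq g e; last first.
  move=> /le_lt_trans/(_ (le_lt_trans (gmul_ler _ (vcomp_le V W g).1) (small g ge gf))).
  by rewrite ltxx.
move=> leVe; have /orthP/(_ e) := spanned_perp SW TY.
rewrite -VWe -gmax_gt0 (lt_le_trans _ leVe) ?gmax_gt0// => /(_ isT)[h he].
move=> /(le_trans leVe); have [->|hf] := eqVneq h f.
  by rewrite Yf hmulx1 leNgt lt.
move=> /le_lt_trans/(_ (le_lt_trans (gmul_ler _ (vcomp_le V W h).2) (small h he hf))).
by rewrite ltxx.
Qed.

Lemma perp_zero : T v0.
Proof. by move=> X _; apply/orthP => e; rewrite ffunE hmulx0 eqxx. Qed.

Lemma perp_rscale a Y : a != 0 -> T Y -> T (rscale a Y).
Proof.
move=> a0 TY X CX; apply/orthP => e; rewrite ffunE hmulA gmul_eq0 negb_or.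
move=> /andP[p0 _]; have /orthP/(_ e p0)[g ge le] := TY X CX.
by exists g => //; rewrite ffunE hmulA; exact: gmul_ler.
Qed.

Lemma perp_comp Y Z : T Y -> T Z -> T (vcomp Y Z).
Proof.
move=> TY TZ X CX; apply/orthP => e; rewrite ffunE.
case: (leP (Y e) (Z e)) => _ p0.
  have /orthP/(_ e p0)[g ge le] := TZ X CX; exists g => //.
  by apply: le_trans le _; apply: gmul_le; exact: (vcomp_le Y Z g).2.
have /orthP/(_ e p0)[g ge le] := TY X CX; exists g => //.
by apply: le_trans le _; apply: gmul_le; exact: (vcomp_le Y Z g).1.
Qed.

Lemma perp_vector_system : vector_system (fun a x => x * a) T.
Proof.
split; [exact: perp_zero|exact: perp_rscale|exact: perp_comp|].
apply: elim_of_pointwise; [exact: perp_zero|exact: perp_comp|].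
move=> Y Y' e f TY TY' YYe Ye lt.
have Yf : Y f != 0 by rewrite -gmax_gt0 (le_lt_trans _ lt)// gmax_ge0.
have ef : e != f by apply: contraTneq lt => <-; rewrite YYe ltxx.
(* Now the second alternative is the desired one. An unbounded coordinate at e forces Z e = 0, and a
   nonzero Z g exceeding its bound would have its inverse in I g. *)
pose I g : set H := if g == e then setT else [set x | x * vcomp Y Y' g < Y f].
have [||[V [SV Vf VI]]|[Z [TZ Zf ZI]]] := @farkas_matroid f I.
- by move=> g; rewrite /I; case: ifP => //= _; rewrite hmul0x gmax_gt0.
- move=> g x y xy; rewrite /I; case: ifP => //= _; apply: le_lt_trans.
  exact: gmul_ler.
- have small g : g != e -> g != f -> V g * vcomp Y Y' g < Y f.
    by move=> ge gf; have := VI g gf; rewrite /I (negPf ge).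
  have /orthP/(_ f) := spanned_perp SV TY; rewrite Vf hmul1x => /(_ Yf)[g gf].
  have [->|ge] := eqVneq g e; last first.
    move=> /le_lt_trans/(_ (le_lt_trans (gmul_le _ (vcomp_le Y Y' g).1) (small g ge gf))).
    by rewrite ltxx.
  move=> leYe; have /orthP/(_ e) := spanned_perp SV TY'.
  rewrite -YYe -gmax_gt0 (lt_le_trans _ leYe) ?gmax_gt0// => /(_ isT)[h he].
  move=> /(le_trans leYe); have [->|hf] := eqVneq h f.
    by rewrite Vf hmul1x leNgt lt.
  move=> /le_lt_trans/(_ (le_lt_trans (gmul_le _ (vcomp_le Y Y' h).2) (small h he hf))).
  by rewrite ltxx.
have Zinv g : g != f -> Z g != 0 -> ~ I g (ginv (Z g)).
  by move=> gf Zg /(ZI g gf); rewrite gmulVx// ltxx.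
have Ze : Z e = 0.
  apply/eqP/negP => /negP Ze; apply: (Zinv e) => //.
  by rewrite /I eqxx.
exists (rscale (Y f) Z); split=> [||g|]; first exact: perp_rscale.
- by rewrite ffunE Ze hmul0x.
- have [->|gf] := eqVneq g f; first by rewrite ffunE Zf hmul1x (vcomp_le Y Y' f).1.
  rewrite [rscale _ _ _]ffunE leNgt; apply/negP => lt'.
  have Zg : Z g != 0.
    by apply: contraTneq lt' => ->; rewrite hmul0x -leNgt gmax_ge0.
  apply: (Zinv g gf Zg); rewrite /I; case: eqP => //= _.
  by have := gmul_lt (ginv_neq0 Zg) lt'; rewrite hmulA gmulVx// hmul1x.
- by rewrite ffunE Zf hmul1x.
Qed.

(** For each f apply the Farkas alternative with the coordinates of W, divided by W f, as bounds:
    either a member of S lies below W and attains it at f, or some Y in T makes the term at f the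
    unique maximum. *)
Lemma perp_perp W : (forall Y, T Y -> orthogonal W Y) -> S W.
Proof.
move=> oW f Wf.
pose I g : set H := [set x | W f * x <= W g].
have [||[V [SV Vf VI]]|[Y [TY Yf YI]]] := @farkas_matroid f I.
- by move=> g; rewrite /I /= hmulx0 gmax_ge0.
- by move=> g x y xy; rewrite /I /=; apply: le_trans; exact: gmul_le.
- have SV' := spanned_lscale Wf SV.
  have V'f : lscale (W f) V f = W f by rewrite ffunE Vf hmulx1.
  have [|X [CX leX Xf]] := SV' f; first by rewrite V'f.
  exists X; split=> // [g|]; last by rewrite Xf.
  apply: le_trans (leX g) _; have [->|gf] := eqVneq g f; first by rewrite V'f.
  by rewrite ffunE; exact: VI.
have /orthP/(_ f) := oW Y TY; rewrite Yf hmulx1 => /(_ Wf)[g gf].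
have wE : W f * (ginv (W f) * W g) = W g by rewrite hmulA gmulV// hmul1x.
have := YI g gf (ginv (W f) * W g); rewrite /I /= wE => /(_ (lexx _)).
by move=> /(gmul_lt Wf); rewrite hmulA wE hmulx1 ltNge => /negP.
Qed.

Let D := minsupp (T `\` [set v0]).

Definition dual_matroid : rmatroid H E :=
  @RMatroid H E D (minsupp_circuit_axioms (rmul_scaling G) perp_vector_system).

Lemma circuit_nonzero X : C X -> X <> v0.
Proof. by move=> CX X0; apply: (circuit_C0 CA); rewrite -X0. Qed.

(** A basis is an independent spanning set; passing to complements, [free_dual_spanning] turns
    independence for S into spanning for T and, with S and T exchanged, conversely. *)
Lemma basis_dual B : basis (supports C) B <-> basis (supports D) (~: B)%SET.
Proof.
rewrite (@basisE C S); first last.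
- move=> V SV /neq_vzero[e Ve]; have [X [CX leX _]] := SV e Ve; exists X => //.
  apply/fintype.subsetP => g; rewrite !in_supp => Xg.
  by rewrite -gmax_gt0 (lt_le_trans _ (leX g))// gmax_gt0.
- by move=> X CX; split; [exact: spanned_circuit|exact: circuit_nonzero].
rewrite (@basisE D T); first last.
- exact: minsupp_exists.
- by move=> X [].
have meet V Y b : S V -> T Y -> V b != 0 -> Y b != 0 ->
     exists g, [/\ g != b, V g != 0 & Y g != 0].
  move=> SV TY Vb Yb; have /orthP/(_ b) := spanned_perp SV TY.
  have p0 : V b * Y b != 0 by rewrite gmul_eq0 negb_or Vb.
  move=> /(_ p0)[g gb le]; exists g.
  have : V g * Y g != 0 by rewrite -gmax_gt0 (lt_le_trans _ le)// gmax_gt0.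
  by rewrite gmul_eq0 negb_or => /andP[].
have paint f A : f \notin A ->
    (exists V, [/\ S V, V f != 0 & supp V \subset (f |: A)%SET]) \/
    (exists Y, [/\ T Y, Y f != 0 & supp Y \subset (~: A)%SET]).
  move=> /(painting CA)[[V [SV Vf VA]]|[Y [TY Yf YA]]]; [left|right].
    exists V; rewrite Vf; split=> //; apply/fintype.subsetP => g.
    rewrite in_supp !inE; apply: contraNT; rewrite negb_or => /andP[gf gA].
    by rewrite VA.
  exists Y; rewrite Yf; split=> //; apply/fintype.subsetP => g.
  by rewrite in_supp inE; apply: contraNN => /YA ->.
have -> := free_dual_spanning B meet paint.
have -> : (forall V, T V -> supp V \subset (~: B)%SET -> V = v0) <->
    (forall g, g \notin B -> exists V, [/\ S V, V g != 0 & supp V \subset (g |: B)%SET]).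
  have := @free_dual_spanning T S (~: B)%SET; rewrite finset.setCK; apply.
    move=> Y V b TY SV Yb Vb; have [g [gb Vg Yg]] := meet V Y b SV TY Vb Yb.
    by exists g.
  move=> f A fA; have fA' : f \notin (~: (f |: A))%SET by rewrite !inE eqxx.
  case: (paint f _ fA') => [[V [SV Vf sV]]|[Y [TY Yf sY]]]; [right|left].
    exists V; split=> //; apply: fintype.subset_trans sV _.
    apply/fintype.subsetP => g; rewrite !inE.
    by have [->|_] := eqVneq g f; rewrite ?fA.
  by exists Y; split=> //; rewrite finset.setCK in sY.
tauto.
Qed.

Lemma dual_matroidP : is_dual M dual_matroid.
Proof. by split=> [|X Y CX [[TY _] _] _]; [exact: basis_dual|exact: TY]. Qed.

(** Equal bases give equal supports, so some Y1 in D has the support of Y and agrees with it at e.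
    For any other g in the support, a circuit X meeting it within {e, g} is orthogonal to both,
    which forces agreement at g. *)
Lemma dual_circuits_perp N : is_dual M N -> rcircuits N `<=` T.
Proof.
move=> [bN oN] Y NY; have NA := rcircuitsP N.
have [Y0 mY0 sY0] : supports D (supp Y).
  apply: (@same_bases_supports (supports (rcircuits N))); last by exists Y.
    by move=> B; have := bN (~: B)%SET; have := basis_dual (~: B)%SET;
      rewrite finset.setCK => -> ->.
  move=> _ _ [X NX <-] [X' NX' <-] /(circuit_C2 NA NX NX')[a /eqP a0 ->].
  by rewrite (supp_vscale X (rmul_scaling G) a0).
have [e Ye] : exists e, Y e != 0.
  by apply/neq_vzero => Y00; apply: (circuit_C0 NA); rewrite -Y00.
have Y0e : Y0 e != 0 by rewrite -in_supp sY0 in_supp.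
have [a a0 ae] := scaling_trans (rmul_scaling G) Y0e Ye.
have mY1 : D (rscale a Y0) := minsupp_scale (rmul_scaling G) perp_vector_system a0 mY0.
set Y1 := rscale a Y0 in mY1; have [[TY1 Y10] _] := mY1.
have sY1 : supp Y1 = supp Y by rewrite -sY0; exact: (supp_vscale Y0 (rmul_scaling G) a0).
have Y1e : Y1 e = Y e by rewrite ffunE.
suff -> : Y = Y1 by [].
apply/ffunP => g; have [->|ge] := eqVneq g e; first by rewrite Y1e.
have [gY|gY] := boolP (g \in supp Y); last first.
  move: (gY); rewrite -{1}sY1 in_supp negbK => /eqP ->.
  by move: gY; rewrite in_supp negbK => /eqP.
(* The second alternative of the painting would be a nonzero member of T supported inside [supp Y]
   without g, against the minimality of Y1. *)
have eA : e \notin (g |: ~: supp Y)%SET by rewrite !inE eq_sym (negPf ge) negbK.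
case: (painting CA eA) => [[V [SV Ve VA]]|[Z [TZ Ze ZA]]]; last first.
  have Z0 : Z <> v0 by apply/neq_vzero; exists e; rewrite Ze.
  have := minsupp_same_supp mY1 TZ Z0; rewrite sY1 => sZ.
  have : g \in supp Z.
    rewrite sZ//; apply/fintype.subsetP => h; rewrite in_supp; apply: contraNT.
    by move=> hY; rewrite ZA// inE [h \in (~: _)%SET]inE hY orbT.
  by rewrite in_supp ZA ?eqxx// !inE eqxx.
have [|X [CX leX Xe]] := SV e; first by rewrite Ve.
have only h : X h != 0 -> Y h != 0 -> (h == e) || (h == g).
  move=> Xh Yh; have [//|he/=] := eqVneq h e; apply: contraNT Xh => hg.
  rewrite -gmax_le0 -(VA h he) ?leX// !inE (negPf hg) /= negbK.
  exact: Yh.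
have only1 h : X h != 0 -> Y1 h != 0 -> (h == e) || (h == g).
  by move=> Xh Yh; apply: only => //; rewrite -in_supp -sY1 in_supp.
have oXY : orthogonal X Y.
  apply: oN => //; apply: (@leq_trans #|[set e; g]%SET|).
    apply: fintype.subset_leq_card; apply/fintype.subsetP => h.
    by rewrite !inE => /andP[]; exact: only.
  by rewrite cards2; case: (_ == _).
have E1 := orth_two oXY only; have E2 := orth_two (TY1 X CX) only1.
have Xg : X g != 0.
  apply: contraNneq Ye => Xg; move: E1; rewrite Xg hmul0x Xe Ve hmul1x => ->.
  by [].
by apply: (gmulKl Xg); rewrite -E1 -E2 Y1e.
Qed.

(** The circuits of [dual_matroid] are cocircuits and span T, so a vector of M is orthogonal to all
    of T and [perp_perp] applies. The converse needs every dual, hence [dual_circuits_perp]. *)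
Lemma vectors_spanned : vectors M = S.
Proof.
apply/seteqP; split=> V hV.
  apply: perp_perp => Y; rewrite {1}(spanned_minsupp (rmul_scaling G) perp_vector_system).
  move=> SY; apply/orthP => e; rewrite gmul_eq0 negb_or => /andP[Ve Ye].
  have [X [mX leX Xe]] := SY e Ye.
  have : orthogonal V X by apply: hV; exists dual_matroid; [exact: dual_matroidP|].
  move/orthP => /(_ e); rewrite Xe gmul_eq0 negb_or Ve => /(_ Ye)[g ge le].
  by exists g => //; apply: le_trans le _; exact: gmul_le.
by move=> Y [N dN NY]; apply: spanned_perp hV _; exact: dual_circuits_perp NY.
Qed.

(** Below every nonzero member of S there is a circuit, so a minimal support is that of a circuit,
    and proportionality identifies the vectors. *)
Lemma circuits_minsupp : C = minsupp (S `\` [set v0]).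
Proof.
have minC X : C X -> minsupp (S `\` [set v0]) X.
  move=> CX; split; first by split; [exact: spanned_circuit|exact: circuit_nonzero].
  move=> V [SV /neq_vzero[e Ve]] lt; have [Z [CZ leZ _]] := SV e Ve.
  have sZ : supp Z \subset supp V.
    apply/fintype.subsetP => g; rewrite !in_supp => Zg.
    by rewrite -gmax_gt0 (lt_le_trans _ (leZ g))// gmax_gt0.
  have ltZ := fintype.sub_proper_trans sZ lt.
  have [a /eqP a0 XE] := circuit_C2 CA CZ CX (fintype.proper_sub ltZ).
  by move: ltZ; rewrite XE supp_lscale// fintype.properxx.
apply/seteqP; split=> [X|V mV]; first exact: minC.
have [[SV V0] _] := mV; have /neq_vzero[e Ve] := V0.
have [X [CX leX _]] := SV e Ve.
have [|a a0 ->] := minsupp_proportional (lmul_scaling G) spanned_vector_system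
  (minC X CX) mV.
  apply/fintype.subsetP => g; rewrite !in_supp => Xg.
  by rewrite -gmax_gt0 (lt_le_trans _ (leX g))// gmax_gt0.
exact: (circuit_C1 CA).
Qed.

End Dual.
End Duality.

(** * Characterization of the vector sets of matroids *)

Theorem theorem24 (d : Order.disp_t) (G : orderedGroupType d) (E : finType)
    (VV : set {ffun E -> Gmax G}) :
  ((exists M : lmatroid (Gmax G) E, VV = vectors M) <->
   [/\ VV (vzero (Gmax G) E),
       (forall (a : G) (V : {ffun E -> Gmax G}),
          VV V -> VV (lscale (Some a : Gmax G) V)),
       (forall V W : {ffun E -> Gmax G}, VV V -> VV W -> VV (vcomp V W)) &
       (forall (V W : {ffun E -> Gmax G}) (e : E), VV V -> VV W ->
          V e = - W e -> V e <> 0 ->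
          exists Z : {ffun E -> Gmax G},
            [/\ VV Z, forall f : E, (V f [+] W f) (Z f) & Z e = 0])]) /\
  (forall M : lmatroid (Gmax G) E, VV = vectors M ->
     circuits M = minsupp (VV `\` [set vzero (Gmax G) E])).
Proof.
split=> [|M ->]; last by rewrite vectors_spanned; exact: circuits_minsupp.
split=> [[M ->]|[V0 V1 V2 V3]].
  rewrite vectors_spanned; have [Z0 Z1 Z2 Z3] := spanned_vector_system M.
  split=> // [a V|V W e SV SW VWe /eqP Ve]; first exact: Z1.
  exact: Z3.
have vs : vector_system (@hmul (Gmax G)) VV.
  split=> // [[a|//] V _|V W e QV QW VWe /eqP Ve]; first exact: V1.
  exact: V3.
(* The circuits are the minimal nonzero members of VV; the vectors of this matroid are their maxima,
   which give back VV. *)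
exists (LMatroid (minsupp_circuit_axioms (lmul_scaling G) vs)).
by rewrite vectors_spanned; exact: (spanned_minsupp (lmul_scaling G) vs).
Qed.
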